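(* Let $X$ and $Y$ be finite-dimensional real symmetric sequence spaces with normalized norms $N_1$ and $N_2$ respectively, with $\dim X=n$ and $\dim Y=m\ge 2$, and suppose that $N_1$ and $N_2$ are not both $\ell_p$-norms with the same $p$. If $\Psi$ is a linear isometry for the norm $N$ on $X(Y)$, then one of the following holds. (i) $\Psi$ is of the form $$(y_1,\dots,y_n)\mapsto(S_1y_{\pi(1)},\dots,S_ny_{\pi(n)})$$ for some isometries $S_i$ of $Y$ and some permutation $\pi$ of $\{1,\dots,n\}$. (ii) $X=\ell_p^n$ and $Y=E_p(2)$ for some $p$ with $1\le p\le\infty$, $p\ne2$, and $\Psi$ permutes the matrices in the set $\{\pm(e_1^Y\pm e_2^Y)(e_j^X)^t:1\le j\le n\}$.
   Context: A finite-dimensional real symmetric sequence space is $\mathbb{R}^d$ with a norm invariant under all permutations and all sign changes of the coordinates; it is normalized if the standard unit vectors have norm $1$. $X(Y)$ is the space of $n$-tuples $(y_1,\dots,y_n)$ of vectors in $Y$ with norm $N(y_1,\dots,y_n)=N_1(N_2(y_1),\dots,N_2(y_n))$. It is identified with the space $\mathbb{R}^{m\times n}$ of real $m\times n$ matrices, $(y_1,\dots,y_n)$ corresponding to the matrix with columns $y_1,\dots,y_n$. Here $e_i^Y\in\mathbb{R}^m$ and $e_j^X\in\mathbb{R}^n$ denote the standard basis column vectors of $Y$ and $X$, and $t$ denotes transpose; the two signs in $\pm(e_1^Y\pm e_2^Y)$ are independent. $E_p(2)$ is $\mathbb{R}^2$ with norm $\|(x,y)\|_{E_p}=\left(\frac{|x+y|^p}{2}+\frac{|x-y|^p}{2}\right)^{1/p}$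 for $1\le p<\infty$, $p\neq2$, and $\|(x,y)\|_{E_\infty}=\max(|x+y|,|x-y|)$. The equalities $X=\ell_p^n$ and $Y=E_p(2)$ mean equality of norms in the standard coordinates. *)

(* Defs.v *)
From mathcomp Require Import all_boot all_order all_fingroup all_algebra.
From mathcomp Require Import boolp classical_sets functions reals constructive_ereal exp.
Set Implicit Arguments.
Unset Strict Implicit.
Unset Printing Implicit Defensive.
Import Order.TTheory GRing.Theory Num.Theory.
Local Open Scope ring_scope.

(* Norms are given as predicates on functions because 'M[R]_(m, n) already
   carries its canonical (maximum) norm. *)
Record is_norm (R : realType) (V : lmodType R) (N : V -> R) : Prop := IsNorm {
  norm_triangle : forall x y : V, N (x + y) <= N x + N y;
  norm_homogeneous : forall (a : R) (x : V), N (a *: x) = `|a| * N x;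
  norm_definite : forall x : V, N x = 0 -> x = 0
}.

Record symmetric_norm (R : realType) (d : nat) (N : 'cV[R]_d -> R) : Prop :=
  SymmetricNorm {
  symmetric_is_norm : is_norm N;
  symmetric_perm : forall (s : 'S_d) (x : 'cV[R]_d), N (row_perm s x) = N x;
  symmetric_sign : forall (e : 'I_d -> bool) (x : 'cV[R]_d),
    N (\col_i ((-1) ^+ e i * x i 0)) = N x
}.

Definition normalized (R : realType) (d : nat) (N : 'cV[R]_d -> R) : Prop :=
  forall i : 'I_d, N (delta_mx i 0) = 1.

Definition mixed_norm (R : realType) (m n : nat)
    (N1 : 'cV[R]_n -> R) (N2 : 'cV[R]_m -> R) (A : 'M[R]_(m, n)) : R :=
  N1 (\col_j N2 (col j A)).

Definition isometry_for (R : realType) (V : lmodType R) (N : V -> R)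
    (f : {linear V -> V}) : Prop := forall x : V, N (f x) = N x.

(* The exponent ranges over the extended reals; only 1 <= p is meaningful, and
   the value at -oo is a dummy. *)
Definition lp_norm (R : realType) (d : nat) (p : \bar R) (x : 'cV[R]_d) : R :=
  match p with
  | EFin r => (\sum_i `|x i 0| `^ r) `^ r^-1
  | +oo%E => \big[Num.max/0]_i `|x i 0|
  | -oo%E => 0
  end.

Definition Ep_norm (R : realType) (p : \bar R) (x y : R) : R :=
  match p with
  | EFin r => (`|x + y| `^ r / 2 + `|x - y| `^ r / 2) `^ r^-1
  | +oo%E => Num.max `|x + y| `|x - y|
  | -oo%E => 0
  end.

Definition coord0 (m : nat) (hm : (1 < m)%N) : 'I_m := Ordinal (ltnW hm).
Definition coord1 (m : nat) (hm : (1 < m)%N) : 'I_m := Ordinal hm.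

Definition is_Ep2 (R : realType) (m : nat) (hm : (1 < m)%N) (p : \bar R)
    (N : 'cV[R]_m -> R) : Prop :=
  m = 2%N /\
  forall y : 'cV[R]_m, N y = Ep_norm p (y (coord0 hm) 0) (y (coord1 hm) 0).

Definition diagonal_atoms (R : realType) (m n : nat) (hm : (1 < m)%N) :
    set 'M[R]_(m, n) :=
  [set A | exists (j : 'I_n) (a b : bool),
     A = (-1) ^+ a *:
         ((delta_mx (coord0 hm) 0 + (-1) ^+ b *: delta_mx (coord1 hm) 0 : 'cV[R]_m)
            *m (delta_mx j 0 : 'cV[R]_n)^T)]%classic.

(* Main.v *)
Require Import Defs.
From HB Require Import structures.
From mathcomp Require Import all_boot all_order all_fingroup all_algebra.
From mathcomp Require Import boolp classical_sets functions reals constructive_ereal exp.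
From mathcomp Require Import ring lra.
Set Implicit Arguments.
Unset Strict Implicit.
Unset Printing Implicit Defensive.
Import Order.TTheory GRing.Theory Num.Theory.
Local Open Scope ring_scope.

(** The proof studies the roots of the mixed norm [N]: the nonzero matrices [u] for
    which the reflection along [u] is an isometry of [N].  Coordinate vectors are
    roots, and so are sums and differences of two coordinate vectors of the same
    column, because [N] is invariant under sign changes and under permutations
    within a column.

    Isometries of [N] are orthogonal for the Euclidean inner product, so that they
    permute the roots.  Indeed, averaging over signed permutations shows that the
    Hilbert-Schmidt norm of an isometry cannot exceed that of the identity
    ([hs_le_dim]); this bound for an isometry and for its inverse forces the
    inverse to be the transpose ([isometry_adjoint], [isometry_dot]).

    If every root lies in one column, then the images of the coordinate vectors of a
    column, being linked by roots, lie in one column.  This is case (i)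
    ([column_form]).

    Otherwise some root crosses columns, and the norms have to be identified.
    Suppose that the difference of a vector [y] in one column and a vector [z] in
    another column is a root, where [y] and [z] have the same length.  The reflection
    exchanges their coefficients, which makes the norm [N1] of vectors with two
    nonzero coordinates an associative operation.  By Bohnenblust's theorem
    ([associative_norm_lp]) it is an lp-norm, and [N2] is computed by the same
    operation as far as the columns decompose along [y] or [z] ([swap_lp]).  When
    [y] or [z] is a coordinate vector, [N2] becomes the same lp-norm, which is
    excluded ([swap_delta_lp]); when both are diagonals [e_1 + e_2] or [e_1 - e_2] of
    a plane, [N2] is the norm of E_p(2) ([cross_root_exceptional]).

    It remains to find such a root.  If unit roots came arbitrarily close to a
    coordinate vector without being equal to it, small rotations would exchange it
    with a coordinate vector of another column in the limit, and this is excluded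
    ([isroot_exchange], [delta_isolated]).  So coordinate vectors are isolated among
    the unit roots, which are therefore finite in number up to sign, and there are
    lowest roots above a given plane ([lowest_root]).  The angles of a lowest root
    with the roots of the plane are so restricted that two entries of a root can be
    deleted ([isroot_prism]).  A crossing root of minimal support has therefore two
    columns only, and yields the root wanted ([two_column_root]).

    Finally, for the exceptional norms an isometry preserves both the Euclidean norm
    and, in the coordinates along the diagonal atoms, the lp-norm with p different
    from 2.  Only multiples of the atoms have the right ratio of these norms, so the
    atoms are permuted ([isometry_atom]).  This is case (ii). *)

(** * The Euclidean inner product *)

Lemma bernoulli (R : realFieldType) (r : R) q : 1 <= r -> 1 + (r - 1) *+ q <= r ^+ q.
Proof.
move=> r1; elim: q => [|q IH]; first by rewrite mulr0n addr0 expr0.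
rewrite exprS mulrSr; have h := ler_wpM2l (le_trans ler01 r1) IH.
have h2 : 0 <= (r - 1) *+ q by rewrite mulrn_wge0 // subr_ge0.
nra.
Qed.

Section Euclid.
Variables (R : realType) (m n : nat).
Implicit Types (A B C u v w x y : 'M[R]_(m, n)) (a c : R).

Definition dot A B : R := \sum_i \sum_j A i j * B i j.

Lemma dotC A B : dot A B = dot B A.
Proof. by apply: eq_bigr => i _; apply: eq_bigr => j _; rewrite mulrC. Qed.

Lemma dotDl A B C : dot (A + B) C = dot A C + dot B C.
Proof.
rewrite /dot -big_split; apply: eq_bigr => i _ /=; rewrite -big_split.
by apply: eq_bigr => j _; rewrite mxE mulrDl.
Qed.

Lemma dotZl a A B : dot (a *: A) B = a * dot A B.
Proof.
rewrite /dot mulr_sumr; apply: eq_bigr => i _; rewrite mulr_sumr.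
by apply: eq_bigr => j _; rewrite mxE mulrA.
Qed.

Lemma dotDr A B C : dot C (A + B) = dot C A + dot C B.
Proof. by rewrite dotC dotDl !(dotC C). Qed.

Lemma dotZr a A B : dot A (a *: B) = a * dot A B.
Proof. by rewrite dotC dotZl dotC. Qed.

Lemma dotNl A B : dot (- A) B = - dot A B.
Proof. by rewrite -scaleN1r dotZl mulN1r. Qed.

Lemma dotNr A B : dot A (- B) = - dot A B.
Proof. by rewrite dotC dotNl dotC. Qed.

Definition dotE := (dotDl, dotDr, dotNl, dotNr, dotZl, dotZr).

Lemma dot0l A : dot 0 A = 0.
Proof. by rewrite -(scale0r (0 : 'M_(m, n))) dotZl mul0r. Qed.

Lemma dot0r A : dot A 0 = 0.
Proof. by rewrite dotC dot0l. Qed.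

Lemma dot_suml (I : finType) (f : I -> 'M[R]_(m, n)) A :
  dot (\sum_i f i) A = \sum_i dot (f i) A.
Proof. exact: (big_morph (dot^~ A) (fun B C => dotDl B C A) (dot0l A)). Qed.

Lemma dot_sumr (I : finType) (f : I -> 'M[R]_(m, n)) A :
  dot A (\sum_i f i) = \sum_i dot A (f i).
Proof. exact: (big_morph (dot A) (fun B C => dotDr B C A) (dot0r A)). Qed.

Lemma dot_delta A i j : dot A (delta_mx i j) = A i j.
Proof.
rewrite /dot (bigD1 i) //= (bigD1 j) //= mxE !eqxx mulr1.
rewrite big1 => [|j' /negbTE nj]; last by rewrite mxE nj andbF mulr0.
rewrite big1 ?addr0 // => i' /negbTE ni.
by rewrite big1 // => j' _; rewrite mxE ni mulr0.
Qed.

Lemma sqr_entry_le A i j : A i j ^+ 2 <= dot A A.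
Proof.
rewrite /dot (bigD1 i) //= (bigD1 j) //= -expr2 -addrA lerDl addr_ge0 //.
  by apply: sumr_ge0 => j' _; rewrite -expr2 sqr_ge0.
by apply: sumr_ge0 => i' _; apply: sumr_ge0 => j' _; rewrite -expr2 sqr_ge0.
Qed.

Lemma dot_ge0 A : 0 <= dot A A.
Proof.
by apply: sumr_ge0 => i' _; apply: sumr_ge0 => j' _; rewrite -expr2 sqr_ge0.
Qed.

Lemma dot_eq0 A : (dot A A == 0) = (A == 0).
Proof.
apply/eqP/eqP => [d0|->]; last by rewrite dot0l.
apply/matrixP => i j; rewrite mxE; apply/eqP.
by rewrite -sqrf_eq0 eq_le sqr_ge0 -{1}d0 sqr_entry_le.
Qed.

Lemma dot_gt0 A : (0 < dot A A) = (A != 0).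
Proof. by rewrite lt_def dot_eq0 dot_ge0 andbT. Qed.

Lemma cauchy_schwarz A B : dot A B ^+ 2 <= dot A A * dot B B.
Proof.
have [->|B0] := eqVneq B 0; first by rewrite !dot0r expr0n mulr0.
have := dot_ge0 (dot B B *: A - dot A B *: B).
rewrite !dotE (dotC B A) => h.
rewrite -dot_gt0 in B0; rewrite -subr_ge0 -(pmulr_rge0 _ B0).
by apply: le_trans h _; rewrite le_eqVlt; apply/orP; left; apply/eqP; ring.
Qed.

Lemma dot_addsqr_le A B : dot (A + B) (A + B) <= 2 * dot A A + 2 * dot B B.
Proof.
have := dot_ge0 (A - B); rewrite !dotE (dotC B A); lra.
Qed.

(** * Reflections and roots *)

Definition refl u x := x - (2 * dot u x / dot u u) *: u.

Lemma refl_linear u : linear (refl u).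
Proof.
by move=> a x y; apply/matrixP => i j; rewrite /refl !dotE !mxE; ring.
Qed.

HB.instance Definition _ u := GRing.isLinear.Build R 'M[R]_(m, n) 'M[R]_(m, n)
  *:%R (refl u) (refl_linear u).

Lemma refl0 x : refl 0 x = x.
Proof. by rewrite /refl scaler0 subr0. Qed.

Lemma dot_refl u x y : dot (refl u x) (refl u y) = dot x y.
Proof.
have [->|u0] := eqVneq u 0; first by rewrite !refl0.
rewrite -dot_eq0 in u0; rewrite /refl !dotE (dotC x u); field.
exact: u0.
Qed.

Lemma reflK u : involutive (refl u).
Proof.
move=> x; have [->|u0] := eqVneq u 0; first by rewrite !refl0.
rewrite -dot_eq0 in u0; rewrite /refl !dotE -addrA -opprD -scalerDl.
rewrite [X in X *: u](_ : _ = 0) ?scale0r ?subr0 //; field; exact: u0.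
Qed.

Lemma dot_refl_swap u x y : dot (refl u x) y = dot x (refl u y).
Proof. by rewrite -(dot_refl u x) reflK. Qed.

Lemma reflZ c u x : c != 0 -> refl (c *: u) x = refl u x.
Proof.
move=> c0; have [->|u0] := eqVneq u 0; first by rewrite scaler0.
rewrite -dot_eq0 in u0; rewrite /refl !dotE scalerA; congr (_ - _ *: _).
by field; rewrite c0 u0.
Qed.

Lemma refl_self u : refl u u = - u.
Proof.
have [->|u0] := eqVneq u 0; first by rewrite refl0 oppr0.
rewrite -dot_eq0 in u0; rewrite /refl mulfK // -{1}[u]scale1r -scalerBl.
by rewrite -scaleN1r; congr (_ *: _); ring.
Qed.

Lemma refl_orth u x : dot u x = 0 -> refl u x = x.
Proof. by rewrite /refl => ->; rewrite mulr0 mul0r scale0r subr0. Qed.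

Lemma refl_unit u x : dot u u = 1 -> refl u x = x - (2 * dot u x) *: u.
Proof. by rewrite /refl => ->; rewrite divr1. Qed.

Lemma refl_map (T : {linear 'M[R]_(m, n) -> 'M[R]_(m, n)}) u x :
  (forall x y, dot (T x) (T y) = dot x y) -> refl (T u) (T x) = T (refl u x).
Proof. by move=> h; rewrite /refl !h (linearB T) (linearZ_LR T). Qed.

Lemma refl_refl u v x : refl (refl u v) x = refl u (refl v (refl u x)).
Proof. by rewrite -{1}[x](reflK u) (@refl_map (refl u)) //; exact: dot_refl. Qed.

(** The difference of the reflections is a combination of two rank one maps
    involving [u - v]; the constant 16 comes from [dot_addsqr_le] and the two
    coefficients 2. *)
Lemma refl_lipschitz u v x : dot u u = 1 -> dot v v = 1 ->
  dot (refl u x - refl v x) (refl u x - refl v x)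
    <= 16 * dot (u - v) (u - v) * dot x x.
Proof.
move=> u1 v1; rewrite !refl_unit //.
have -> : x - (2 * dot u x) *: u - (x - (2 * dot v x) *: v)
  = (- 2 * dot (u - v) x) *: u + (- 2 * dot v x) *: (u - v).
  apply/matrixP => i j; rewrite !dotE !mxE; ring.
apply: le_trans (dot_addsqr_le _ _) _.
have h1 := cauchy_schwarz (u - v) x; have h2 := cauchy_schwarz v x.
rewrite v1 mul1r in h2.
have h3 : dot v x ^+ 2 * dot (u - v) (u - v) <= dot x x * dot (u - v) (u - v).
  by apply: ler_wpM2r h2; exact: dot_ge0.
rewrite !(dotZl, dotZr) u1; lra.
Qed.

Section Roots.
Variable N : 'M[R]_(m, n) -> R.

(** Roots are not normalized, so that they can be written with coordinates 0, 1
    and -1. *)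
Definition isroot u := u != 0 /\ forall x, N (refl u x) = N x.

Lemma isrootZ c u : c != 0 -> isroot u -> isroot (c *: u).
Proof.
move=> c0 [u0 hu]; split; first by rewrite scaler_eq0 negb_or c0.
by move=> x; rewrite reflZ.
Qed.

Lemma isrootN u : isroot u -> isroot (- u).
Proof. by rewrite -scaleN1r; apply: isrootZ; rewrite oppr_eq0 oner_eq0. Qed.

(** The reflection in [refl u v] is the conjugate by [refl u] of that in [v]. *)
Lemma isroot_refl u v : isroot u -> isroot v -> isroot (refl u v).
Proof.
move=> [u0 hu] [v0 hv]; split; first by rewrite -dot_eq0 dot_refl dot_eq0.
by move=> x; rewrite refl_refl hu hv hu.
Qed.

End Roots.
End Euclid.

(** * Symmetric norms and the mixed norm *)

Section Norms.
Variables (R : realType) (V : lmodType R) (N : V -> R).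
Hypothesis hN : is_norm N.

Lemma is_norm0 : N 0 = 0.
Proof. by rewrite -(scale0r (0 : V)) (norm_homogeneous hN) normr0 mul0r. Qed.

Lemma is_normN x : N (- x) = N x.
Proof. by rewrite -scaleN1r (norm_homogeneous hN) normrN1 mul1r. Qed.

Lemma is_norm_ge0 x : 0 <= N x.
Proof.
have := norm_triangle hN x (- x); rewrite is_normN subrr is_norm0; lra.
Qed.

Lemma is_norm_sum (I : finType) (f : I -> V) : N (\sum_i f i) <= \sum_i N (f i).
Proof.
apply: (big_ind2 (fun x y => N x <= y)); first by rewrite is_norm0.
  by move=> x1 x2 y1 y2 h1 h2; apply: le_trans (norm_triangle hN _ _) (lerD h1 h2).
by [].
Qed.

Lemma is_norm_dist x y : `|N x - N y| <= N (x - y).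
Proof.
have h1 := norm_triangle hN (x - y) y; have h2 := norm_triangle hN (y - x) x.
rewrite subrK in h1; rewrite subrK -opprB is_normN in h2.
by rewrite ler_norml; apply/andP; split; lra.
Qed.
End Norms.

Section SymmetricNorms.
Variables (R : realType) (d : nat) (N : 'cV[R]_d -> R).
Hypotheses (hN : symmetric_norm N).
Let nN := symmetric_is_norm hN.
Implicit Types x y : 'cV[R]_d.

Definition set_entry x i a : 'cV[R]_d := \col_k (if k == i then a else x k 0).

Lemma set_entryE x i : set_entry x i (x i 0) = x.
Proof. by apply/colP => k; rewrite mxE; case: eqP => // ->. Qed.

(** The smaller value is a convex combination of the larger one and its opposite. *)
Lemma symmetric_norm_set_entry x i a b : `|a| <= `|b| -> N (set_entry x i a) <= N (set_entry x i b).
Proof.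
have [->|b0 ab] := eqVneq b 0.
  by rewrite normr0 normr_le0 => /eqP ->.
pose t := a / b.
have t1 : `|t| <= 1 by rewrite normrM normfV ler_pdivrMr ?normr_gt0 // mul1r.
have -> : set_entry x i a = ((1 + t) / 2) *: set_entry x i b + ((1 - t) / 2) *: set_entry x i (- b).
  apply/colP => k; by rewrite !mxE /t; case: ifP => _; field.
apply: le_trans (norm_triangle nN _ _) _; rewrite !(norm_homogeneous nN).
have -> : N (set_entry x i (- b)) = N (set_entry x i b).
  rewrite -(symmetric_sign hN (fun k => k == i)); congr N.
  by apply/colP => k; rewrite !mxE; case: ifP => _; rewrite ?expr1 ?expr0; ring.
rewrite ler_norml in t1; case/andP: t1 => t1 t2.
by rewrite !ger0_norm; lra.
Qed.

(** It suffices to change the coordinates one at a time. *)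
Lemma symmetric_norm_le x y : (forall i, `|x i 0| <= `|y i 0|) -> N x <= N y.
Proof.
move=> xy; pose z (s : seq 'I_d) : 'cV[R]_d := \col_k (if k \in s then x k 0 else y k 0).
have hz s : N (z s) <= N y.
  elim: s => [|i s].
    by have -> : z [::] = y by apply/colP => k; rewrite mxE.
  move=> IH; apply: le_trans IH; have -> : z (i :: s) = set_entry (z s) i (x i 0).
    by apply/colP => k; rewrite !mxE in_cons; case: eqP => // ->.
  rewrite -{2}(set_entryE (z s) i); apply: symmetric_norm_set_entry.
  by rewrite mxE; case: ifP.
have -> : x = z (enum 'I_d) by apply/colP => k; rewrite mxE mem_enum.
exact: hz.
Qed.

Lemma symmetric_norm_abs x y : (forall i, `|x i 0| = `|y i 0|) -> N x = N y.
Proof.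
by move=> xy; apply/eqP; rewrite eq_le !symmetric_norm_le // => i; rewrite xy.
Qed.

Hypothesis hn : normalized N.

Lemma normalizedZ i a : N (a *: delta_mx i 0) = `|a|.
Proof. by rewrite (norm_homogeneous nN) hn mulr1. Qed.

Lemma normalized_entry_le x i : `|x i 0| <= N x.
Proof.
rewrite -(normalizedZ i); apply: symmetric_norm_le => k.
rewrite !mxE andbT; case: eqP => [->|_]; first by rewrite mulr1.
by rewrite mulr0 normr0.
Qed.

Lemma normalized_le_sum x : N x <= \sum_i `|x i 0|.
Proof.
have {1}-> : x = \sum_i x i 0 *: delta_mx i 0.
  apply/colP => k; rewrite summxE (bigD1 k) //= big1 => [|i /negbTE ik].
    by rewrite !mxE !eqxx mulr1 addr0.
  by rewrite !mxE eq_sym ik mulr0.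
apply: le_trans (is_norm_sum nN _) _.
by apply: ler_sum => i _; rewrite normalizedZ.
Qed.

End SymmetricNorms.

Section MixedNorm.
Variables (R : realType) (m n : nat) (N1 : 'cV[R]_n -> R) (N2 : 'cV[R]_m -> R).
Hypotheses (hN1 : symmetric_norm N1) (hN1n : normalized N1).
Hypotheses (hN2 : symmetric_norm N2) (hN2n : normalized N2).
Let nN1 := symmetric_is_norm hN1.
Let nN2 := symmetric_is_norm hN2.
Local Notation N := (mixed_norm N1 N2).
Local Notation V := 'M[R]_(m, n).
Implicit Types (A B u v x : V).

Lemma mixed_is_norm : is_norm N.
Proof.
split=> [A B|a A|A].
- apply: le_trans (norm_triangle nN1 _ _); apply: symmetric_norm_le => // j.
  rewrite !mxE !ger0_norm ?addr_ge0 ?(is_norm_ge0 nN2) //.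
  by rewrite linearD; exact: (norm_triangle nN2).
- rewrite /mixed_norm -(norm_homogeneous nN1).
  apply: symmetric_norm_abs => // j; rewrite !mxE.
  have -> : col j (a *: A) = a *: col j A by apply/colP => i; rewrite !mxE.
  by rewrite (norm_homogeneous nN2) !normrM normr_id.
- move=> /(norm_definite nN1)/colP h; apply/matrixP => i j.
  have := h j; rewrite !mxE => /(norm_definite nN2)/colP/(_ i).
  by rewrite !mxE.
Qed.
Let nN := mixed_is_norm.

Lemma mixed_entry_le A i j : `|A i j| <= N A.
Proof.
apply: le_trans (normalized_entry_le hN1 hN1n _ j).
have := normalized_entry_le hN2 hN2n (col j A) i; rewrite !mxE => h.
by apply: le_trans h _; exact: ler_norm.
Qed.

Lemma mixed_le_sum A : N A <= \sum_j \sum_i `|A i j|.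
Proof.
apply: le_trans (normalized_le_sum hN1 hN1n _) _; apply: ler_sum => j _.
rewrite mxE ger0_norm ?(is_norm_ge0 nN2) //.
apply: le_trans (normalized_le_sum hN2 hN2n _) _.
by apply: ler_sum => i _; rewrite mxE.
Qed.

Lemma mixed_eq_col A B : (forall j, N2 (col j A) = N2 (col j B)) -> N A = N B.
Proof. by move=> h; congr N1; apply/colP => j; rewrite !mxE h. Qed.

Lemma mixed_sign (e : 'I_m -> 'I_n -> bool) A :
  N (\matrix_(i, j) ((-1) ^+ e i j * A i j)) = N A.
Proof.
apply: mixed_eq_col => j; rewrite -(symmetric_sign hN2 (e^~ j) (col j A)).
by congr N2; apply/colP => i; rewrite !mxE.
Qed.

Lemma mixed_row_perm (s : 'I_n -> 'S_m) A : N (\matrix_(i, j) A (s j i) j) = N A.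
Proof.
apply: mixed_eq_col => j; rewrite -(symmetric_perm hN2 (s j) (col j A)).
by congr N2; apply/colP => i; rewrite !mxE.
Qed.

Lemma mixed_col_perm (t : 'S_n) A : N (\matrix_(i, j) A i (t j)) = N A.
Proof.
rewrite /mixed_norm -(symmetric_perm hN1 t (\col_j N2 (col j A))).
congr N1; apply/colP => j; rewrite !mxE; congr N2.
by apply/colP => i; rewrite !mxE.
Qed.

Definition permute_mx (s : 'S_m) (t : 'S_n) A : V := \matrix_(i, j) A (s i) (t j).

Lemma permute_mx_linear s t : linear (permute_mx s t).
Proof. by move=> a x y; apply/matrixP => i j; rewrite !mxE. Qed.

HB.instance Definition _ s t := GRing.isLinear.Build R V V *:%R (permute_mx s t)
  (permute_mx_linear s t).

Lemma mixed_permute_mx s t A : N (permute_mx s t A) = N A.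
Proof.
rewrite -(mixed_col_perm t A) -(mixed_row_perm (fun=> s) (\matrix_(i, j) A i (t j))).
by congr N; apply/matrixP => i j; rewrite !mxE.
Qed.

Lemma dot_permute_mx s t A B : dot (permute_mx s t A) (permute_mx s t B) = dot A B.
Proof.
rewrite /dot (reindex_inj (@perm_inj _ s^-1%g)) /=; apply: eq_bigr => i _.
rewrite (reindex_inj (@perm_inj _ t^-1%g)) /=; apply: eq_bigr => j _.
by rewrite !mxE !permKV.
Qed.

Lemma permute_mxK s t A : permute_mx s t (permute_mx s^-1%g t^-1%g A) = A.
Proof. by apply/matrixP => i j; rewrite !mxE !permK. Qed.

(** An orthogonal isometry conjugates the reflection in [u] to that in [T u]. *)
Lemma isroot_map (T : {linear V -> V}) (T' : V -> V) u :
  (forall x y, dot (T x) (T y) = dot x y) -> (forall x, N (T x) = N x) ->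
  (forall x, T (T' x) = x) -> isroot N u -> isroot N (T u).
Proof.
move=> od oN TT' [u0 hu]; split; first by rewrite -dot_eq0 od dot_eq0.
by move=> x; rewrite -(TT' x) refl_map // !oN hu.
Qed.

Lemma isroot_permute_mx s t u : isroot N u -> isroot N (permute_mx s t u).
Proof.
by move=> hu; apply: (@isroot_map (permute_mx s t) (permute_mx s^-1%g t^-1%g)) => //;
  [exact: dot_permute_mx | exact: mixed_permute_mx | exact: permute_mxK].
Qed.

Lemma delta_neq0 i j : (delta_mx i j : V) != 0.
Proof.
by apply/eqP => /matrixP/(_ i j); rewrite !mxE !eqxx => /eqP; rewrite oner_eq0.
Qed.

Lemma isroot_delta i j : isroot N (delta_mx i j).
Proof.
split=> [|x]; first exact: delta_neq0.
rewrite -(mixed_sign (fun i' j' => (i' == i) && (j' == j)) x); congr N.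
apply/matrixP => i' j'; rewrite /refl [dot _ x]dotC !dot_delta !mxE !eqxx divr1.
case: eqP => [->|_] /=; last by rewrite mulr0 subr0 expr0 mul1r.
case: eqP => [->|_] /=; last by rewrite mulr0 subr0 expr0 mul1r.
by rewrite expr1; ring.
Qed.

(** This reflection exchanges two entries of column j. *)
Lemma isroot_deltaB (i i' : 'I_m) (j : 'I_n) : i != i' -> isroot N (delta_mx i j - delta_mx i' j).
Proof.
move=> ii'; have ii'' : (i' == i) = false by rewrite eq_sym (negbTE ii').
split=> [|x].
  apply/eqP => /matrixP/(_ i j); rewrite !mxE !eqxx (negbTE ii') subr0.
  by move/eqP; rewrite oner_eq0.
rewrite -(mixed_row_perm (fun j' => if j' == j then tperm i i' else 1%g) x); congr N.
apply/matrixP => k j'; rewrite /refl [dot _ x]dotC !(dotDr, dotNr, dot_delta) !mxE.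
rewrite !eqxx (negbTE ii') ii'' /=.
case: (eqVneq j' j) => [->|_]; last by rewrite !andbF perm1 subrr mulr0 subr0.
rewrite !andbT; case: tpermP => [->|->|/eqP/negbTE -> /eqP/negbTE ->].
- by rewrite eqxx (negbTE ii') /=; field.
- by rewrite eqxx ii'' /=; field.
- by rewrite /= subrr mulr0 subr0.
Qed.

Lemma isroot_deltaD (i i' : 'I_m) (j : 'I_n) : i != i' -> isroot N (delta_mx i j + delta_mx i' j).
Proof.
move=> ii'; have := isroot_refl (isroot_delta i' j) (isroot_deltaB j ii').
rewrite linearB /= refl_self opprK refl_orth // dot_delta mxE.
by rewrite (negbTE ii').
Qed.

End MixedNorm.

(** * Isometries are orthogonal *)

Section Orthogonality.
Variables (R : realType) (m n : nat) (N1 : 'cV[R]_n -> R) (N2 : 'cV[R]_m -> R).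
Hypotheses (hN1 : symmetric_norm N1) (hN1n : normalized N1).
Hypotheses (hN2 : symmetric_norm N2) (hN2n : normalized N2).
Local Notation N := (mixed_norm N1 N2).
Local Notation V := 'M[R]_(m, n).
Local Notation K := ('I_m * 'I_n)%type.
Local Notation E := (fun k : K => delta_mx k.1 k.2 : V).
Implicit Types (T S : {linear V -> V}) (x y : V).

Lemma dot_pair x y : dot x y = \sum_(k : K) x k.1 k.2 * y k.1 k.2.
Proof. by rewrite /dot pair_big. Qed.

Lemma sum_delta x : x = \sum_(k : K) x k.1 k.2 *: E k.
Proof. by rewrite {1}[x]matrix_sum_delta pair_big. Qed.

Lemma linear_sum_delta T x : T x = \sum_(k : K) x k.1 k.2 *: T (E k).
Proof.
by rewrite {1}[x]sum_delta linear_sum; apply: eq_bigr => k _; rewrite linearZ.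
Qed.

(** The squared Hilbert-Schmidt norm. *)
Definition hs T : R := \sum_(k : K) dot (T (E k)) (T (E k)).

Lemma sum_sign (k l : K) :
  \sum_(e : {ffun K -> bool}) ((-1) ^+ e k * (-1) ^+ e l : R)
    = #|{ffun K -> bool}|%:R *+ (k == l).
Proof.
have [->|kl] := eqVneq k l.
  rewrite (eq_bigr (fun=> 1)) ?sumr_const ?mulr1n // => e _.
  by rewrite -expr2 sqrr_sign.
pose f (e : {ffun K -> bool}) := [ffun i => if i == k then ~~ e i else e i].
have fK : involutive f.
  by move=> e; apply/ffunP => i; rewrite !ffunE; case: (i == k); rewrite ?negbK.
rewrite mulr0n; set s := \sum_e _.
have : s = - s.
  rewrite {1}/s (reindex_inj (inv_inj fK)) /= /s -sumrN; apply: eq_bigr => e _.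
  by rewrite !ffunE eqxx eq_sym (negbTE kl); case: (e k); rewrite ?expr1 ?expr0; ring.
lra.
Qed.

Lemma perm_average d (f : 'I_d -> R) i :
  d%:R * \sum_(s : 'S_d) f (s i) = #|'S_d|%:R * \sum_k f k.
Proof.
have h k : \sum_(s : 'S_d) f (s i) = \sum_(s : 'S_d) f (s k).
  rewrite (reindex_inj (mulgI (tperm i k))) /=; apply: eq_bigr => s _.
  by rewrite permM tpermL.
transitivity (\sum_(k : 'I_d) \sum_(s : 'S_d) f (s k)).
  by rewrite -(eq_bigr _ (fun k _ => h k)) sumr_const card_ord mulr_natl.
rewrite exchange_big /= mulr_natl -sumr_const; apply: eq_bigr => s _.
by rewrite [RHS](reindex_inj (@perm_inj _ s)).
Qed.

(** The signs vary entrywise, the permutations are those of rows and columns: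
    enough isometries for the averages in [signed_perm_average]. *)
Definition signed_perm (h : {ffun K -> bool} * ('S_m * 'S_n)) x : V :=
  \matrix_(i, j) ((-1) ^+ h.1 (i, j) * x (h.2.1 i) (h.2.2 j)).

Lemma signed_perm_linear h : linear (signed_perm h).
Proof. by move=> a x y; apply/matrixP => i j; rewrite !mxE; ring. Qed.

HB.instance Definition _ h := GRing.isLinear.Build R V V *:%R (signed_perm h)
  (signed_perm_linear h).

Lemma mixed_signed_perm h x : N (signed_perm h x) = N x.
Proof.
rewrite -(mixed_permute_mx hN1 hN2 h.2.1 h.2.2 x).
rewrite -(mixed_sign N1 hN2 (fun i j => h.1 (i, j)) (permute_mx _ _ x)).
by congr N; apply/matrixP => i j; rewrite !mxE.
Qed.

(** Averaging over the signs removes the products of different entries of [x];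
    averaging over the permutations gives all squares of entries the same weight.
    The two sides are multiplied by the dimension and by the order of the group. *)
Lemma signed_perm_average T x :
  (m * n)%:R * \sum_h dot (T (signed_perm h x)) (T (signed_perm h x))
    = (#|{ffun K -> bool}| * (#|'S_m| * #|'S_n|))%:R * (dot x x * hs T).
Proof.
pose c k := dot (T (E k)) (T (E k)).
have -> : \sum_h dot (T (signed_perm h x)) (T (signed_perm h x)) =
    \sum_(p : 'S_m * 'S_n) #|{ffun K -> bool}|%:R *
      \sum_(k : K) x (p.1 k.1) (p.2 k.2) ^+ 2 * c k.
  rewrite -(pair_bigA _ (fun e p => dot (T (signed_perm (e, p) x)) (T (signed_perm (e, p) x)))) /=.
  rewrite exchange_big /=; apply: eq_bigr => p _.
  pose y k := x (p.1 k.1) (p.2 k.2).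
  transitivity (\sum_(e : {ffun K -> bool}) \sum_k \sum_l
     ((-1) ^+ e k * (-1) ^+ e l) * (y k * y l * dot (T (E k)) (T (E l)))).
    apply: eq_bigr => e _; rewrite linear_sum_delta dot_suml; apply: eq_bigr => k _.
    rewrite dot_sumr; apply: eq_bigr => l _.
    by rewrite !(dotZl, dotZr) !mxE -!surjective_pairing /y; ring.
  rewrite exchange_big /= mulr_sumr; apply: eq_bigr => k _.
  rewrite exchange_big /= (bigD1 k) //= -mulr_suml sum_sign eqxx mulr1n.
  rewrite big1 => [|l lk]; last by rewrite -mulr_suml sum_sign eq_sym (negbTE lk) mulr0n mul0r.
  by rewrite addr0 /y /c; ring.
rewrite -mulr_sumr.
have -> : \sum_(p : 'S_m * 'S_n) \sum_(k : K) x (p.1 k.1) (p.2 k.2) ^+ 2 * c k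
   = \sum_(k : K) (\sum_(s : 'S_m) \sum_(t : 'S_n) x (s k.1) (t k.2) ^+ 2) * c k.
  rewrite exchange_big /=; apply: eq_bigr => k _.
  rewrite -mulr_suml; congr (_ * _).
  by rewrite (pair_bigA _ (fun (s : 'S_m) (t : 'S_n) => x (s k.1) (t k.2) ^+ 2)).
have hk (k : K) : (m * n)%:R * (\sum_(s : 'S_m) \sum_(t : 'S_n) x (s k.1) (t k.2) ^+ 2)
    = (#|'S_m| * #|'S_n|)%:R * dot x x.
  pose f i := n%:R * \sum_(t : 'S_n) x i (t k.2) ^+ 2.
  have -> : (m * n)%:R * (\sum_(s : 'S_m) \sum_(t : 'S_n) x (s k.1) (t k.2) ^+ 2)
      = m%:R * \sum_(s : 'S_m) f (s k.1) by rewrite -mulr_sumr natrM mulrA.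
  rewrite perm_average natrM -mulrA; congr (_ * _).
  rewrite mulr_sumr; apply: eq_bigr => i _.
  by rewrite /f (perm_average (fun j => x i j ^+ 2)).
rewrite mulrCA mulr_sumr [in RHS]natrM -[RHS]mulrA; congr (_ * _).
under eq_bigr do rewrite mulrA hk.
by rewrite -mulr_sumr mulrA.
Qed.

Lemma delta_norm_le1 k : N (E k) <= 1.
Proof.
apply: le_trans (mixed_le_sum hN1 hN1n hN2 hN2n _) _; rewrite exchange_big /=.
rewrite (pair_bigA _ (fun i j => `|E k i j|)) (bigD1 k) //= big1 => [|l lk].
  by rewrite mxE !eqxx normr1 addr0.
rewrite mxE; case: k l lk => [i j] [i' j'] /=; rewrite xpair_eqE.
by move/negbTE => ->; rewrite normr0.
Qed.

(** An isometry has entries of absolute value at most 1. *)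
Lemma hs_le T : (forall x, N (T x) = N x) -> hs T <= (m * n)%:R ^+ 2.
Proof.
move=> hT; have -> : (m * n)%:R ^+ 2 = \sum_(k : K) \sum_(l : K) (1 : R).
  by rewrite !sumr_const card_prod !card_ord -natrX -mulnn -mulrnA.
apply: ler_sum => k _; rewrite dot_pair; apply: ler_sum => l _.
have := mixed_entry_le hN1 hN1n hN2 hN2n (T (E k)) l.1 l.2; rewrite hT => h.
have {}h := le_trans h (delta_norm_le1 k).
by rewrite -expr2 -real_normK ?num_real // expr_le1.
Qed.

(** Apply [signed_perm_average] to the images under [S] of the coordinate vectors: on
    average over [h] the two sides are equal, so some [h] reaches the average. *)
Lemma hs_mul T S : exists h, hs S * hs T <= (m * n)%:R * hs (T \o signed_perm h \o S).
Proof.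
apply: contrapT => /forallNP hlt.
have hsum : (m * n)%:R * \sum_h hs (T \o signed_perm h \o S) =
    \sum_(h : {ffun K -> bool} * ('S_m * 'S_n)) hs S * hs T.
  rewrite exchange_big /= mulr_sumr sumr_const !card_prod.
  under eq_bigr do rewrite signed_perm_average.
  by rewrite -mulr_sumr -mulr_suml mulr_natl.
rewrite mulr_sumr in hsum.
suff : \sum_h (m * n)%:R * hs (T \o signed_perm h \o S) <
    \sum_(h : {ffun K -> bool} * ('S_m * 'S_n)) hs S * hs T by rewrite hsum ltxx.
apply: ltr_sum => [|h _]; last by rewrite ltNge; apply/negP/hlt.
by apply/hasP; exists ([ffun=> false], (1%g, 1%g)); rewrite ?mem_index_enum.
Qed.

(** If the Hilbert-Schmidt norm of [T] exceeded that of the identity, then by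
    [hs_mul] it would grow geometrically along products of copies of [T] with
    suitable signed permutations, although it is bounded on isometries. *)
Lemma hs_le_dim T : (forall x, N (T x) = N x) -> hs T <= (m * n)%:R.
Proof.
move=> hT; rewrite leNgt; apply/negP => dT.
have d0 : 0 < (m * n)%:R :> R.
  rewrite lt_neqAle ler0n andbT; apply/eqP => d0.
  by have := hs_le hT; move: dT; rewrite -d0 expr0n /=; lra.
pose r := hs T / (m * n)%:R.
have r1 : 1 < r by rewrite ltr_pdivlMr // mul1r.
have grow q : exists S : {linear V -> V}, (forall x, N (S x) = N x) /\
    (m * n)%:R * r ^+ q <= hs S.
  elim: q => [|q [S [hS IH]]].
    exists idfun; split => //; rewrite expr0 mulr1 /hs.
    under eq_bigr do rewrite /= dot_delta mxE !eqxx.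
    by rewrite sumr_const card_prod !card_ord.
  have [h hh] := hs_mul T S; exists (T \o signed_perm h \o S : {linear V -> V}); split.
    by move=> x /=; rewrite hT mixed_signed_perm hS.
  rewrite -(ler_pM2l d0); apply: le_trans hh.
  have -> : (m * n)%:R * ((m * n)%:R * r ^+ q.+1) = hs T * ((m * n)%:R * r ^+ q).
    rewrite exprSr; move: (r ^+ q) d0 => p; rewrite /r; move: ((m * n)%:R : R) => D D0.
    by field; rewrite gt_eqF.
  by rewrite [leRHS]mulrC ler_pM2l // (lt_trans d0).
have r10 : 0 < r - 1 by rewrite subr_gt0.
have hq := archi_boundP (ltW (divr_gt0 d0 r10)).
set q := Num.bound _ in hq.
have [S [hS hS2]] := grow q.
have := le_trans hS2 (hs_le hS); rewrite expr2 ler_pM2l // => h3.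
have := le_trans (bernoulli q (ltW r1)) h3.
rewrite ltr_pdivrMr // mulr_natl in hq; lra.
Qed.

(** An isometry is injective, hence invertible in finite dimension. *)
Lemma isometry_inverse T : (forall x, N (T x) = N x) ->
  exists T' : {linear V -> V}, [/\ forall x, N (T' x) = N x,
    forall x, T (T' x) = x & forall x, T' (T x) = x].
Proof.
move=> hT.
have inj x : T x = 0 -> x = 0.
  move=> Tx; apply: (norm_definite (mixed_is_norm hN1 hN2)).
  by rewrite -hT Tx (is_norm0 (mixed_is_norm hN1 hN2)).
have uT : lin_mx T \in unitmx.
  rewrite -row_free_unit; apply: inj_row_free => v.
  rewrite -[v]vec_mxK mul_vec_lin => /eqP; rewrite -[0]/(0 : 'rV_(m * n)).
  by rewrite -(linear0 mxvec) (can_eq mxvecK) => /eqP/inj ->.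
have lT' : linear (fun x : V => vec_mx (mxvec x *m invmx (lin_mx T)) : V).
  by move=> a x y; rewrite !linearP /= mulmxDl -scalemxAl linearP.
pose T' : {linear V -> V} := HB.pack (fun x : V => vec_mx (mxvec x *m invmx (lin_mx T)) : V)
  (GRing.isLinear.Build R V V *:%R _ lT').
have T'K x : T (T' x) = x.
  by apply: (can_inj mxvecK); rewrite -(mul_vec_lin T) /T' /= vec_mxK mulmxKV.
have TK x : T' (T x) = x by rewrite /T' /= -(mul_vec_lin T) mulmxK // mxvecK.
by exists T'; split => // x; rewrite -hT T'K.
Qed.

(** The squared Hilbert-Schmidt distance of [T] from the transpose of its inverse
    is [hs T + hs T'] minus twice the dimension, which [hs_le_dim] makes
    nonpositive. *)
Lemma isometry_adjoint T T' : (forall x, N (T x) = N x) ->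
  (forall x, N (T' x) = N x) -> (forall x, T' (T x) = x) ->
  forall x y, dot (T x) y = dot x (T' y).
Proof.
move=> hT hT' TK.
have hsum : \sum_(k : K) \sum_(l : K)
    (T (E k) l.1 l.2 - T' (E l) k.1 k.2) ^+ 2 = hs T + hs T' - (m * n)%:R *+ 2.
  have -> : hs T' = \sum_(k : K) \sum_(l : K) T' (E l) k.1 k.2 ^+ 2.
    by rewrite exchange_big; apply: eq_bigr => k _; rewrite dot_pair.
  have -> : (m * n)%:R = \sum_(k : K) \sum_(l : K) T (E k) l.1 l.2 * T' (E l) k.1 k.2.
    transitivity (\sum_(k : K) (1 : R)).
      by rewrite sumr_const card_prod !card_ord.
    apply: eq_bigr => k _; have := linear_sum_delta T' (T (E k)); rewrite TK.
    move=> e; transitivity ((E k) k.1 k.2); first by rewrite mxE !eqxx.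
    rewrite [LHS](congr1 (fun A : V => A k.1 k.2) e) summxE.
    by apply: eq_bigr => l _; rewrite mxE.
  rewrite -sumrMnl /hs -!big_split -sumrB; apply: eq_bigr => k _ /=.
  rewrite dot_pair -sumrMnl -big_split -sumrB; apply: eq_bigr => l _ /=; ring.
have h1 := hs_le_dim hT; have h2 := hs_le_dim hT'.
have hE (k l : K) : T (E k) l.1 l.2 = T' (E l) k.1 k.2.
  have ge0 (k' l' : K) : 0 <= (T (E k') l'.1 l'.2 - T' (E l') k'.1 k'.2) ^+ 2.
    exact: sqr_ge0.
  have ge0' (k' : K) : 0 <= \sum_l' (T (E k') l'.1 l'.2 - T' (E l') k'.1 k'.2) ^+ 2.
    by apply: sumr_ge0.
  have le0 : hs T + hs T' - (m * n)%:R *+ 2 <= 0 by lra.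
  have eq0 : hs T + hs T' - (m * n)%:R *+ 2 = 0.
    by apply/eqP; rewrite eq_le le0 -hsum sumr_ge0.
  rewrite eq0 in hsum.
  have h := psumr_eq0P (fun k' _ => ge0' k') hsum.
  have h' := psumr_eq0P (fun l' _ => ge0 k l') (h k isT).
  have := h' l isT.
  by move/eqP; rewrite sqrf_eq0 subr_eq0 => /eqP.
move=> x y; rewrite linear_sum_delta dot_suml dot_pair; apply: eq_bigr => k _.
rewrite dotZl; congr (_ * _); rewrite dot_pair (linear_sum_delta T' y) summxE.
by apply: eq_bigr => l _; rewrite hE mxE mulrC.
Qed.

Lemma isometry_dot T : (forall x, N (T x) = N x) ->
  forall x y, dot (T x) (T y) = dot x y.
Proof.
move=> hT x y; have [T' [hT' _ TK]] := isometry_inverse hT.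
by rewrite (isometry_adjoint hT hT' TK) TK.
Qed.

End Orthogonality.

(** * Associative norms in two variables *)

Section AssociativeNorms.
Variables (R : realType).
Implicit Types (s t x y z c : R).

Definition lp_pair (p : \bar R) (s t : R) : R :=
  match p with
  | EFin r => (s `^ r + t `^ r) `^ r^-1
  | +oo%E => Num.max s t
  | -oo%E => 0
  end.

Lemma powRVK r s : r != 0 -> 0 <= s -> (s `^ r^-1) `^ r = s.
Proof. by move=> r0 s0; rewrite -powRrM mulVf // powRr1. Qed.

Lemma powRKV r s : r != 0 -> 0 <= s -> (s `^ r) `^ r^-1 = s.
Proof. by move=> r0 s0; rewrite -powRrM mulfV // powRr1. Qed.

(** If [x / y] exceeded 1, its powers would exceed 2. *)
Lemma le_of_expr_le2 x y : 0 < x -> 0 < y ->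
  (forall b : nat, x ^+ b <= 2 * y ^+ b) -> x <= y.
Proof.
move=> x0 y0 h; rewrite leNgt; apply/negP => yx.
pose r := x / y; have r1 : 1 < r by rewrite ltr_pdivlMr // mul1r.
have r10 : 0 < r - 1 by rewrite subr_gt0.
have hq := archi_boundP (ltW (divr_gt0 (ltr01 : 0 < 1 :> R) r10)).
set q := Num.bound _ in hq; rewrite ltr_pdivrMr // mulr_natl in hq.
have h1 := bernoulli q (ltW r1); have := h q.
by rewrite -ler_pdivrMr ?exprn_gt0 // -expr_div_n -/r; lra.
Qed.

(** An associative, homogeneous, monotone addition on the half-line with
    [1 + 1 = 2] is the ordinary one.  The [k]-fold sums [Psi k] of [1] are monotone
    and multiplicative in [k] and agree with [k] at the powers of two.  Comparing
    powers of [k] with powers of two shows that [Psi k = k] for all [k];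
    homogeneity extends this to rationals, monotonicity to reals. *)
Section Addition.
Variable K : R -> R -> R.
Hypothesis K0 : forall s, 0 <= s -> K s 0 = s.
Hypothesis KC : forall s t, 0 <= s -> 0 <= t -> K s t = K t s.
Hypothesis KZ : forall c s t, 0 <= c -> 0 <= s -> 0 <= t ->
  K (c * s) (c * t) = c * K s t.
Hypothesis KL : forall s s' t t', 0 <= s -> 0 <= t -> s <= s' -> t <= t' ->
  K s t <= K s' t'.
Hypothesis KA : forall x y z, 0 <= x -> 0 <= y -> 0 <= z ->
  K x (K y z) = K y (K x z).
Hypothesis K11 : K 1 1 = 2.

Let Psi (k : nat) : R := iter k (K 1) 0.

Lemma addition_ge0 s t : 0 <= s -> 0 <= t -> 0 <= K s t.
Proof. by move=> s0 t0; apply: (le_trans s0); rewrite -{1}(K0 s0) KL. Qed.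

Let Psi_ge0 k : 0 <= Psi k.
Proof. by elim: k => //= k IH; rewrite addition_ge0. Qed.

Let PsiD a b : K (Psi a) (Psi b) = Psi (a + b)%N.
Proof.
elim: a => [|a IH]; first by rewrite KC // K0.
have -> : Psi a.+1 = K 1 (Psi a) by [].
rewrite KC ?addition_ge0 // KA // [K (Psi b) _]KC // IH //.
Qed.

Let PsiM a b : Psi (a * b)%N = Psi a * Psi b.
Proof.
elim: a => [|a IH]; first by rewrite mul0r.
rewrite mulSn -PsiD IH -{1}[Psi b]mulr1 [Psi a * _]mulrC KZ // mulrC.
by [].
Qed.

Let PsiX a b : Psi (a ^ b)%N = Psi a ^+ b.
Proof.
elim: b => [|b IH]; first by rewrite expn0 expr0 /Psi /= K0.
by rewrite expnS exprS PsiM IH.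
Qed.

Let Psi_le a b : (a <= b)%N -> Psi a <= Psi b.
Proof.
move=> /subnKC <-; rewrite -PsiD -{1}(K0 (Psi_ge0 a)); exact: KL.
Qed.

Let Psi2 : Psi 2 = 2.
Proof. by rewrite /Psi /= K0. Qed.

Let PsiE k : Psi k = k%:R.
Proof.
have [->//|k0] := posnP k.
have Psik : 1 <= Psi k by apply: le_trans (Psi_le k0); rewrite /Psi /= K0.
have Pk0 : 0 < Psi k by apply: lt_le_trans Psik.
have k0' : 0 < k%:R :> R by rewrite ltr0n.
have bnd b : Psi k ^+ b <= 2 * k%:R ^+ b /\ k%:R ^+ b <= 2 * Psi k ^+ b.
  have kb : (0 < k ^ b)%N by rewrite expn_gt0 k0.
  have /andP[h1 h2] := trunc_log_bounds (isT : (1 < 2)%N) kb.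
  set a := trunc_log 2 (k ^ b) in h1 h2.
  (* Both k ^ b and its image lie between 2 ^ a and 2 ^ a.+1. *)
  have h3 := Psi_le h1; have h4 := Psi_le (ltnW h2).
  rewrite !PsiX Psi2 in h3 h4; rewrite exprS in h4.
  have h5 : (2 ^ a)%:R <= (k ^ b)%:R :> R by rewrite ler_nat.
  have h6 : (k ^ b)%:R <= (2 ^ a.+1)%:R :> R by rewrite ler_nat ltnW.
  rewrite expnS natrM in h6; rewrite !natrX in h5 h6; split; lra.
by apply/eqP; rewrite eq_le !le_of_expr_le2 // => b; case: (bnd b).
Qed.

Lemma addition_unique s t : 0 <= s -> 0 <= t -> K s t = s + t.
Proof.
move=> s0 t0.
have bnd (M : nat) : `|K s t - (s + t)| *+ M <= 2.
  (* Round M * s and M * t down and up to integers. *)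
  have M0 : 0 <= M%:R :> R by exact: ler0n.
  have /andP[k1 k2] := truncn_itv (mulr_ge0 M0 s0).
  have /andP[l1 l2] := truncn_itv (mulr_ge0 M0 t0).
  set k := Num.truncn _ in k1 k2; set l := Num.truncn _ in l1 l2.
  have h1 := KL (ler0n _ k) (ler0n _ l) k1 l1.
  have h2 := KL (mulr_ge0 M0 s0) (mulr_ge0 M0 t0) (ltW k2) (ltW l2).
  rewrite -!PsiE !PsiD !PsiE KZ // !natrD in h1 h2.
  rewrite -addn1 -(addn1 l) !natrD in h2 k2 l2.
  rewrite -[X in X <= _]mulr_natl -(ger0_norm M0) -normrM ler_norml mulrBr mulrDr.
  by apply/andP; split; lra.
apply/eqP; rewrite -subr_eq0 -normr_eq0; apply/eqP.
have d0 := normr_ge0 (K s t - (s + t)); set d := `|_| in bnd d0 *.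
apply/eqP; rewrite eq_le d0 andbT leNgt; apply/negP => dpos.
have hq := archi_boundP (ltW (divr_gt0 (ltr0n R 2) dpos)).
set q := Num.bound _ in hq; have := bnd q.
by rewrite ltr_pdivrMr // mulr_natl in hq; lra.
Qed.
End Addition.

(** Bohnenblust's characterization of the lp-norms in two variables.  If
    [h 1 1 <= 1], monotonicity forces the maximum.  Otherwise [r] is chosen such
    that [h 1 1 `^ r = 2]; conjugated by the power map of exponent [r], the norm
    becomes an addition as in [addition_unique]. *)
Lemma associative_norm_lp (h : R -> R -> R) :
  (forall s, 0 <= s -> h s 0 = s) ->
  (forall s t, 0 <= s -> 0 <= t -> h s t = h t s) ->
  (forall c s t, 0 <= c -> 0 <= s -> 0 <= t -> h (c * s) (c * t) = c * h s t) ->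
  (forall s s' t t', 0 <= s -> 0 <= t -> s <= s' -> t <= t' -> h s t <= h s' t') ->
  (forall x y z, 0 <= x -> 0 <= y -> 0 <= z -> h x (h y z) = h y (h x z)) ->
  h 1 1 <= 2 ->
  exists p : \bar R, (1%:E <= p)%E /\
    forall s t, 0 <= s -> 0 <= t -> h s t = lp_pair p s t.
Proof.
move=> h0 hC hZ hL hA h2.
have hge0 := addition_ge0 h0 hL.
have [h11|h11] := leP (h 1 1) 1.
  exists +oo%E; split; first by rewrite leey.
  move=> s t s0 t0; apply/eqP; rewrite eq_le /=; apply/andP; split.
    have M0 : 0 <= Num.max s t by rewrite le_max s0.
    apply: (@le_trans _ _ (h (Num.max s t * 1) (Num.max s t * 1))).
      by apply: hL => //; rewrite mulr1 le_max lexx ?orbT.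
    by rewrite hZ // ler_piMr.
  rewrite ge_max; apply/andP; split; first by rewrite -{1}(h0 s s0) hL.
  by rewrite -{1}(h0 t t0) (hC s) // hL.
pose r := ln 2 / ln (h 1 1).
have l0 : 0 < ln (h 1 1) by exact: ln_gt0.
have hpos : 0 < h 1 1 by apply: lt_trans h11.
have r1 : 1 <= r by rewrite ler_pdivlMr // mul1r ler_ln ?posrE.
have r0 : 0 < r by apply: lt_le_trans r1.
have rn0 : r != 0 by rewrite gt_eqF.
have hr : h 1 1 `^ r = 2.
  by rewrite /powR gt_eqF // /r divfK ?gt_eqF // lnK // posrE.
have rV0 : 0 <= r^-1 by rewrite invr_ge0 ltW.
pose K s t := h (s `^ r^-1) (t `^ r^-1) `^ r.
have KE s t : 0 <= s -> 0 <= t -> K s t = s + t.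
  apply: addition_unique.
  - by move=> {}s s0; rewrite /K powR0 ?invr_eq0 // h0 ?powR_ge0 // powRVK.
  - by move=> {}s {}t s0 t0; rewrite /K hC ?powR_ge0.
  - move=> c {}s {}t c0 s0 t0; rewrite /K !powRM // hZ ?powR_ge0 //.
    by rewrite powRM ?powR_ge0 ?hge0 ?powR_ge0 // powRVK.
  - move=> {}s s' {}t t' s0 t0 ss tt; apply: ge0_ler_powR => //; rewrite ?nnegrE.
    + exact: ltW.
    + by rewrite hge0 ?powR_ge0.
    + by rewrite hge0 ?powR_ge0.
    + apply: hL; rewrite ?powR_ge0 //.
        by apply: ge0_ler_powR; rewrite ?nnegrE // (le_trans s0).
      by apply: ge0_ler_powR; rewrite ?nnegrE // (le_trans t0).
  - move=> x y z x0 y0 z0; rewrite /K.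
    have KV a b : (h (a `^ r^-1) (b `^ r^-1) `^ r) `^ r^-1 = h (a `^ r^-1) (b `^ r^-1).
      by apply: powRKV => //; apply: hge0; exact: powR_ge0.
    transitivity (h (x `^ r^-1) (h (y `^ r^-1) (z `^ r^-1)) `^ r).
      by congr (h _ _ `^ _); exact: KV.
    transitivity (h (y `^ r^-1) (h (x `^ r^-1) (z `^ r^-1)) `^ r).
      by congr (_ `^ _); apply: hA; apply: powR_ge0.
    by congr (h _ _ `^ _); symmetry; exact: KV.
  - by rewrite /K powR1.
exists r%:E; split; first by rewrite lee_fin.
move=> s t s0 t0; rewrite /lp_pair -KE ?powR_ge0 // /K.
by rewrite (powRKV rn0 s0) (powRKV rn0 t0) powRKV // hge0.
Qed.

End AssociativeNorms.

Section Fuse.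
Variables (R : realType) (d : nat).
Implicit Types (x y : 'cV[R]_d) (A B : 'cV[R]_d -> R).

Definition fuse (h : R -> R -> R) (i j : 'I_d) x : 'cV[R]_d :=
  \col_k (if k == i then h `|x i 0| `|x j 0| else if k == j then 0 else x k 0).

Definition fusible h A := forall i j x, i != j -> A x = A (fuse h i j x).

(** Merging pairs of nonzero coordinates reduces the support to one coordinate. *)
Lemma fusible_unique h A B : fusible h A -> fusible h B ->
  A 0 = B 0 -> (forall i a, A (a *: delta_mx i 0) = B (a *: delta_mx i 0)) ->
  A =1 B.
Proof.
move=> hA hB e0 e1 x.
have [q] := ubnP #|[set k | x k 0 != 0]|; elim: q x => // q IH x xq.
have [i xi|x0] := pickP (fun i => x i 0 != 0); last first.
  have -> : x = 0 by apply/colP => k; have /negbFE/eqP := x0 k; rewrite mxE.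
  exact: e0.
have [j /andP[ji xj]|xi'] := pickP (fun j => (j != i) && (x j 0 != 0)); last first.
  have -> : x = x i 0 *: delta_mx i 0; last exact: e1.
  apply/colP => k; rewrite !mxE andbT; have := xi' k; case: eqVneq => [->|_ /=].
    by rewrite mulr1.
  by move/negbFE/eqP => ->; rewrite mulr0.
have ij : i != j by rewrite eq_sym.
rewrite (hA i j x ij) (hB i j x ij); apply: IH.
apply: (@leq_trans #|[set k | x k 0 != 0]|); last by rewrite -ltnS.
apply: proper_card; apply/properP; split.
  apply/fintype.subsetP => k; rewrite !inE mxE; have [->|_] := eqVneq k i; first by rewrite xi.
  by have [_|//] := eqVneq k j; rewrite eqxx.
exists j; rewrite ?inE // mxE (negbTE ji) eqxx eqxx //.
Qed.

Lemma lp_fusible p : (1%:E <= p)%E -> fusible (lp_pair p) (@lp_norm R d p).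
Proof.
move=> p1 i j x ij; case: p p1 => [r r1|_|]; last by rewrite leeNy_eq.
  rewrite lee_fin in r1; rewrite /lp_norm; have r0 : 0 < r by apply: lt_le_trans r1.
  congr (_ `^ _); rewrite (bigD1 i) //= (bigD1 j) 1?eq_sym //= [RHS](bigD1 i) //=.
  rewrite [in RHS](bigD1 j) 1?eq_sym //= !mxE !eqxx eq_sym (negbTE ij).
  rewrite /lp_pair (ger0_norm (powR_ge0 _ _)) powRVK ?gt_eqF ?addr_ge0 ?powR_ge0 //.
  rewrite normr0 powR0 ?gt_eqF // add0r addrA; congr (_ + _).
  by apply: eq_bigr => k /andP[ki kj]; rewrite mxE (negbTE ki) (negbTE kj).
have nmax (a b : R) : `|Num.max `|a| `|b| | = Num.max `|a| `|b|.
  by rewrite ger0_norm // le_max normr_ge0.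
apply/eqP; rewrite eq_le /lp_norm; apply/andP; split; apply/bigmax_leP.
  split; first by rewrite bigmax_idl le_max lexx.
  move=> k _; have [->|ki] := eqVneq k i.
    by apply: le_trans (le_bigmax _ _ i); rewrite mxE eqxx nmax le_max lexx.
  have [->|kj] := eqVneq k j.
    by apply: le_trans (le_bigmax _ _ i); rewrite mxE eqxx nmax le_max lexx orbT.
  by apply: le_trans (le_bigmax _ _ k); rewrite mxE (negbTE ki) (negbTE kj).
split; first by rewrite bigmax_idl le_max lexx.
move=> k _; rewrite mxE; case: eqP => [_|_].
  by rewrite nmax ge_max !le_bigmax.
case: eqP => [_|_]; last exact: le_bigmax.
by rewrite normr0 bigmax_idl le_max lexx.
Qed.

Lemma lp_norm_delta p i a : (1%:E <= p)%E -> @lp_norm R d p (a *: delta_mx i 0) = `|a|.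
Proof.
case: p => [r| |] //=.
  rewrite lee_fin => r1; have r0 : 0 < r by apply: lt_le_trans r1.
  rewrite (bigD1 i) //= !mxE !eqxx mulr1 big1 ?addr0 ?powRKV ?gt_eqF //.
  by move=> k /negbTE ki; rewrite !mxE ki mulr0 normr0 powR0 ?gt_eqF.
move=> _; apply/eqP; rewrite eq_le; apply/andP; split.
  apply/bigmax_leP; split => // k _; rewrite !mxE; case: (_ && _).
    by rewrite mulr1.
  by rewrite mulr0 normr0.
by apply: le_trans (le_bigmax _ _ i); rewrite !mxE !eqxx mulr1.
Qed.

Lemma lp_norm0 p : (1%:E <= p)%E -> @lp_norm R d p 0 = 0.
Proof.
case: p => [r| |] //=.
  rewrite lee_fin => r1; have r0 : 0 < r by apply: lt_le_trans r1.
  rewrite big1 ?powR0 ?invr_eq0 ?gt_eqF // => k _.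
  by rewrite mxE normr0 powR0 ?gt_eqF.
move=> _; rewrite big1_idem //= ?maxxx // => k _; by rewrite mxE normr0.
Qed.

Lemma fusible_lp p A : symmetric_norm A -> normalized A -> (1%:E <= p)%E ->
  fusible (lp_pair p) A -> A =1 lp_norm p.
Proof.
move=> sA nA p1 hA; apply: (fusible_unique hA (lp_fusible p1)).
  by rewrite lp_norm0 // (is_norm0 (symmetric_is_norm sA)).
by move=> i a; rewrite lp_norm_delta // normalizedZ.
Qed.

End Fuse.

(** * Roots that exchange vectors of two columns *)

Lemma perm_two d (p q p' q' : 'I_d) : p != q -> p' != q' ->
  exists s : 'S_d, s p = p' /\ s q = q'.
Proof.
move=> pq pq'; exists (tperm p p' * tperm (tperm p p' q) q')%g; rewrite !permM tpermL.
split; last by rewrite tpermL.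
have c1 : tperm p p' q != p'.
  by apply: contra pq => /eqP e; rewrite -(inj_eq (@perm_inj _ (tperm p p'))) tpermL e.
have c2 : q' != p' by rewrite eq_sym.
exact: (tpermD c1 c2).
Qed.

Section SwapSymmetry.
Variables (R : realType) (m n : nat) (N1 : 'cV[R]_n -> R) (N2 : 'cV[R]_m -> R).
Hypotheses (hN1 : symmetric_norm N1) (hN1n : normalized N1).
Hypotheses (hN2 : symmetric_norm N2) (hN2n : normalized N2).
Local Notation N := (mixed_norm N1 N2).
Local Notation V := 'M[R]_(m, n).
Let nN1 := symmetric_is_norm hN1.
Let nN2 := symmetric_is_norm hN2.

Definition at_col (j : 'I_n) (y : 'cV[R]_m) : V := \matrix_(i, k) (y i 0 *+ (k == j)).

Lemma at_col_linear j : linear (at_col j).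
Proof.
move=> a x y; apply/matrixP => i k; rewrite !mxE; case: (k == j); rewrite ?mulr1n //.
by rewrite !mulr0n mulr0 addr0.
Qed.

HB.instance Definition _ j := GRing.isLinear.Build R 'cV[R]_m V *:%R (at_col j)
  (at_col_linear j).

Lemma col_at_col j k y : col k (at_col j y) = if k == j then y else 0.
Proof. by apply/colP => i; rewrite !mxE; case: (k == j); rewrite ?mulr1n ?mulr0n ?mxE. Qed.

Lemma at_col_delta j i : at_col j (delta_mx i 0) = delta_mx i j.
Proof. by apply/matrixP => i' k; rewrite !mxE andbT; case: (i' == i); case: (k == j). Qed.

Lemma dot_at_col j y (A : V) : dot (at_col j y) A = dot y (col j A).
Proof.
rewrite /dot; apply: eq_bigr => i _; rewrite big_ord1 (bigD1 j) //= big1 ?addr0.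
  by rewrite !mxE eqxx mulr1n.
by move=> k /negbTE kj; rewrite !mxE kj mulr0n mul0r.
Qed.

Section Swap.
Variables (i0 : 'I_m) (j j' : 'I_n) (y y' z z' : 'cV[R]_m).
Hypotheses (jj' : j != j') (yz : dot y y = dot z z).
Hypothesis swap_root : isroot N (at_col j y - at_col j' z).
Hypotheses (y0 : y != 0) (yy' : dot y y' = 0) (zz' : dot z z' = 0).
Hypotheses (Ny' : N2 y' = N2 y) (Nz' : N2 z' = N2 z).

Definition set_pair (r : 'cV[R]_n) (a b : R) : 'cV[R]_n :=
  \col_k (if k == j then a else if k == j' then b else r k 0).

(** As [y] and [z] have the same length, the reflection in
    [at_col j y - at_col j' z] exchanges the coefficient of [y] in column [j] with
    that of [z] in column [j'] and fixes everything else.  The other columns carry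
    the entries of [r] in some row [i0]. *)
Lemma swap_mixed r s t Y Z : dot y Y = 0 -> dot z Z = 0 ->
  N1 (set_pair r (N2 (s *: y + Y)) (N2 (t *: z + Z))) =
  N1 (set_pair r (N2 (t *: y + Y)) (N2 (s *: z + Z))).
Proof.
move=> hY hZ; have j'j : (j' == j) = false by rewrite eq_sym (negbTE jj').
pose A s t : V := at_col j (s *: y + Y) + at_col j' (t *: z + Z) +
  \sum_(k | (k != j) && (k != j')) at_col k (r k 0 *: delta_mx i0 0).
have colA s' t' k : col k (A s' t') = if k == j then s' *: y + Y
    else if k == j' then t' *: z + Z else r k 0 *: delta_mx i0 0.
  rewrite /A !linearD /= !col_at_col linear_sum /=.
  under eq_bigr do rewrite col_at_col.
  have [->|kj] := eqVneq k j.
    rewrite eq_sym j'j addr0 big1 ?addr0 // => l /andP[lj _].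
    by rewrite eq_sym (negbTE lj).
  have [->|kj'] := eqVneq k j'.
    rewrite !add0r big1 ?addr0 // => l /andP[_ lj].
    by rewrite eq_sym (negbTE lj).
  rewrite !add0r (bigD1 k) ?kj ?kj' //= eqxx big1 ?addr0 // => l /andP[_ lk].
  by rewrite eq_sym (negbTE lk).
have NA s' t' : N (A s' t') = N1 (set_pair r (N2 (s' *: y + Y)) (N2 (t' *: z + Z))).
  rewrite /mixed_norm; apply: symmetric_norm_abs => // k; rewrite !mxE colA.
  case: ifP => // _; case: ifP => // _.
  by rewrite normalizedZ // normr_id.
rewrite -!NA; case: swap_root => _ <-; congr N.
have yy0 : dot z z != 0 by rewrite -yz dot_eq0.
rewrite /refl.
have -> : dot (at_col j y - at_col j' z) (A s t) = (s - t) * dot z z.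
  rewrite dotDl dotNl !dot_at_col !colA eqxx j'j eqxx !dotE hY hZ yz; ring.
have -> : dot (at_col j y - at_col j' z) (at_col j y - at_col j' z) = 2 * dot z z.
  rewrite !dotE !dot_at_col !col_at_col eqxx j'j (negbTE jj') eqxx !dot0r yz; ring.
have -> : 2 * ((s - t) * dot z z) / (2 * dot z z) = s - t by field.
rewrite /A !linearD /= !linearZ /=; apply/matrixP => i k; rewrite !mxE; ring.
Qed.

Let h a b := N1 (set_pair 0 a b).

Let h0 a : 0 <= a -> h a 0 = a.
Proof.
move=> a0; rewrite -{2}(ger0_norm a0) -(normalizedZ hN1 hN1n j); congr N1.
apply/colP => k; rewrite !mxE andbT; case: (k == j); first by rewrite mulr1.
by rewrite mulr0; case: ifP.
Qed.

Let hC a b : h a b = h b a.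
Proof.
rewrite /h -(symmetric_perm hN1 (tperm j j')); congr N1; apply/colP => k.
have j'j : (j' == j) = false by rewrite eq_sym (negbTE jj').
rewrite !mxE; case: tpermP => [->|->|/eqP/negbTE -> /eqP/negbTE -> //].
  by rewrite eqxx j'j eqxx.
by rewrite eqxx j'j eqxx.
Qed.

Let hZ c a b : 0 <= c -> h (c * a) (c * b) = c * h a b.
Proof.
move=> c0; rewrite -{3}(ger0_norm c0) -(norm_homogeneous nN1); congr N1.
by apply/colP => k; rewrite !mxE; case: ifP => // _; case: ifP => // _; rewrite mulr0.
Qed.

Let hL a a' b b' : 0 <= a -> 0 <= b -> a <= a' -> b <= b' -> h a b <= h a' b'.
Proof.
move=> a0 b0 aa bb; apply: symmetric_norm_le => // k; rewrite !mxE.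
have a0' := le_trans a0 aa; have b0' := le_trans b0 bb.
by case: ifP => _; [|case: ifP => _ //]; rewrite !ger0_norm.
Qed.

Let h11 : h 1 1 <= 2.
Proof.
have -> : h 1 1 = N1 (delta_mx j 0 + delta_mx j' 0).
  congr N1; apply/colP => k; rewrite !mxE !andbT.
  have [->|_] := eqVneq k j; first by rewrite (negbTE jj') addr0.
  by rewrite add0r; case: ifP.
by apply: le_trans (norm_triangle nN1 _ _) _; rewrite !hN1n.
Qed.

Let h_ge0 a b : 0 <= h a b.
Proof. exact: is_norm_ge0. Qed.

Let ay : 0 < N2 y.
Proof.
rewrite lt_neqAle is_norm_ge0 // andbT eq_sym; apply: contra y0 => /eqP.
by move/(norm_definite nN2) => ->.
Qed.

Let scaleyN c : N2 (c *: y) = `|c| * N2 y.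
Proof. exact: (norm_homogeneous nN2). Qed.

(** Swapping moves the [z]-part of the vector to a column of its own, where only
    its norm counts; so [N2] is computed by the two-variable norm [h]. *)
Let gz t w : N2 (t *: z + w *: z') = h (N2 y * `|t|) (N2 z * `|w|).
Proof.
have e : dot z (w *: z') = 0 by rewrite dotZr zz' mulr0.
have := swap_mixed 0 0 t (dot0r y) e.
rewrite !addr0 !scale0r !add0r !(norm_homogeneous nN2) Nz' (is_norm0 nN2) -/(h _ _).
by rewrite hC h0 ?(is_norm_ge0 nN2) // => ->; rewrite /h ![_ * N2 _]mulrC.
Qed.

Let gy s w : N2 (s *: y + w *: y') = h (N2 y * `|w|) (N2 z * `|s|).
Proof.
have e : dot y (w *: y') = 0 by rewrite dotZr yy' mulr0.
have := swap_mixed 0 s 0 e (dot0r z).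
rewrite !addr0 !scale0r !add0r !(norm_homogeneous nN2) Ny' (is_norm0 nN2) -/(h _ _).
by rewrite h0 ?(is_norm_ge0 nN2) // => ->; rewrite /h ![_ * N2 _]mulrC.
Qed.

Lemma swap_norm_eq : N2 z = N2 y.
Proof.
have := gy 1 0; rewrite scale0r addr0 scale1r normr0 normr1 mulr0 mulr1 hC.
by rewrite h0 ?(is_norm_ge0 nN2).
Qed.

(** Swap the coefficients [a] and [b] in the matrix with columns [a *: y] and
    [b *: z + c *: z']: by [gz] both sides are iterates of [h]. *)
Let hA a b c : 0 <= a -> 0 <= b -> 0 <= c -> h a (h b c) = h b (h a c).
Proof.
move=> a0 b0 c0.
have e : dot z (c *: z') = 0 by rewrite dotZr zz' mulr0.
have := swap_mixed 0 a b (dot0r y) e.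
rewrite !gz !addr0 !scaleyN !swap_norm_eq -/(h _ _) -/(h _ _) !ger0_norm // !hZ ?ltW //.
rewrite ![_ * N2 y]mulrC !hZ ?(ltW ay) // => h1.
by apply: (mulfI (lt0r_neq0 ay)).
Qed.

(** Scaling [y'] in column [j] and [z] in column [j'] suitably, the swap moves
    everything into column [j].  By symmetry any other two columns also merge. *)
Let fusible_N1 : fusible h N1.
Proof.
have fuse_jj' (x : 'cV_n) : N1 x = N1 (fuse h j j' x).
  pose a := N2 y.
  have e : dot y ((`|x j 0| / a) *: y') = 0 by rewrite dotZr yy' mulr0.
  have := swap_mixed x (`|x j' 0| / a) 0 e (dot0r z).
  rewrite gy !scale0r !add0r !addr0 !(norm_homogeneous nN2) (is_norm0 nN2) Ny'.
  rewrite swap_norm_eq -/a !normrM !normr_id normfV (ger0_norm (ltW ay)).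
  rewrite !divfK ?gt_eqF // ![a * (_ / a)]mulrC !divfK ?gt_eqF // => h1.
  transitivity (N1 (set_pair x `|x j 0| `|x j' 0|)).
    apply: symmetric_norm_abs => // k; rewrite !mxE; case: eqP => [->|_].
      by rewrite normr_id.
    by case: eqP => [->|_ //]; rewrite normr_id.
  by rewrite -h1; congr N1; apply/colP => k; rewrite !mxE.
move=> p q x pq; have [s [sj sj']] := perm_two jj' pq.
rewrite -(symmetric_perm hN1 s x) -(symmetric_perm hN1 s (fuse h p q x)) fuse_jj'.
congr N1; apply/colP => k; rewrite !mxE sj sj' -sj -sj' !(inj_eq perm_inj).
by [].
Qed.

Let h_lp : exists p : \bar R, (1%:E <= p)%E /\
  forall s t, 0 <= s -> 0 <= t -> h s t = lp_pair p s t.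
Proof.
exact: (associative_norm_lp h0 (fun a b _ _ => hC a b)
  (fun c a b c0 _ _ => hZ a b c0) hL hA h11).
Qed.

Let N1_lp p : (1%:E <= p)%E ->
  (forall s t, 0 <= s -> 0 <= t -> h s t = lp_pair p s t) -> N1 =1 lp_norm p.
Proof.
move=> p1 hp; apply: fusible_lp => // i k x ik; rewrite (fusible_N1 x ik); congr N1.
by apply/colP => l; rewrite !mxE hp.
Qed.

(** By [hA] and [fusible_N1] the norm [N1] on two coordinates is associative and
    determines [N1]; by [gz] it also determines [N2] on the span of [z] and [z']. *)
Lemma swap_lp : exists p : \bar R, [/\ (1%:E <= p)%E, N1 =1 lp_norm p &
  forall t w, N2 (t *: z + w *: z') = N2 y * lp_pair p `|t| `|w|].
Proof.
have [p [p1 hp]] := h_lp; exists p; split=> //; first exact: N1_lp.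
by move=> t w; rewrite gz swap_norm_eq hZ ?(ltW ay) // hp.
Qed.

(** If [y] is a coordinate vector, every matrix column splits orthogonally along
    [y] and, by symmetry, along any coordinate vector.  So [hE] recovers [N2] from
    [h], one coordinate at a time, and associativity merges two coordinates. *)
Lemma swap_delta_lp i : y = delta_mx i 0 ->
  exists p : \bar R, [/\ (1%:E <= p)%E, N1 =1 lp_norm p & N2 =1 lp_norm p].
Proof.
move=> yi; have [p [p1 hp]] := h_lp.
have Ny : N2 y = 1 by rewrite yi hN2n.
have hE (k : 'I_m) s (Y : 'cV[R]_m) : Y k 0 = 0 -> N2 (s *: delta_mx k 0 + Y) = h (N2 Y) `|s|.
  move=> Yk; rewrite -(symmetric_perm hN2 (tperm i k)) -(symmetric_perm hN2 (tperm i k) Y).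
  set Y' := row_perm _ Y.
  have hY : dot y Y' = 0 by rewrite yi dotC dot_delta !mxE tpermL.
  have -> : row_perm (tperm i k) (s *: delta_mx k 0 + Y) = s *: y + Y'.
    apply/colP => l; rewrite yi !mxE; congr (_ * _%:R + _).
    by rewrite -(inj_eq (@perm_inj _ (tperm i k)) l i) tpermL.
  have := swap_mixed 0 s 0 hY (dot0r z).
  rewrite !scale0r !add0r !addr0 (norm_homogeneous nN2 _ z) (is_norm0 nN2) -/(h _ _).
  by rewrite h0 ?(is_norm_ge0 nN2) // -/(h _ _) swap_norm_eq Ny mulr1.
exists p; split => //; first exact: N1_lp.
apply: fusible_lp => // k l x kl.
pose Z : 'cV[R]_m := \col_q (if (q == k) || (q == l) then 0 else x q 0).
have lk : (l == k) = false by rewrite eq_sym (negbTE kl).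
have ex : x = x k 0 *: delta_mx k 0 + (x l 0 *: delta_mx l 0 + Z).
  apply/colP => q; rewrite !mxE !andbT; have [->|qk] := eqVneq q k.
    by rewrite (negbTE kl) /= mulr1 mulr0 !addr0.
  have [->|ql] /= := eqVneq q l; first by rewrite mulr1 mulr0 addr0 add0r.
  by rewrite !mulr0 !add0r.
have -> : fuse (lp_pair p) k l x = h `|x k 0| `|x l 0| *: delta_mx k 0 + Z.
  apply/colP => q; rewrite !mxE andbT -hp //; have [->|qk] /= := eqVneq q k.
    by rewrite mulr1 addr0.
  by rewrite mulr0 add0r.
rewrite [in LHS]ex.
have Zk : Z k 0 = 0 by rewrite mxE eqxx.
have Zl : Z l 0 = 0 by rewrite mxE eqxx orbT.
have Wk : (x l 0 *: delta_mx l 0 + Z) k 0 = 0.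
  by rewrite mxE Zk addr0 !mxE (negbTE kl) mulr0.
rewrite (hE k _ _ Wk) (hE l _ _ Zl) (hE k _ _ Zk).
rewrite (ger0_norm (h_ge0 _ _)) hC hA ?(is_norm_ge0 nN2) //.
Qed.

End Swap.
End SwapSymmetry.

(** * Accumulating roots *)

Section Accumulating.
Variables (R : realType) (m n : nat) (N1 : 'cV[R]_n -> R) (N2 : 'cV[R]_m -> R).
Hypotheses (hN1 : symmetric_norm N1) (hN1n : normalized N1).
Hypotheses (hN2 : symmetric_norm N2) (hN2n : normalized N2).
Local Notation N := (mixed_norm N1 N2).
Local Notation V := 'M[R]_(m, n).
Implicit Types (e f g u v w x y : V).

Definition unit_root u := isroot N u /\ dot u u = 1.

Lemma unit_root_refl u v : unit_root u -> unit_root v -> unit_root (refl u v).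
Proof.
by move=> [ru u1] [rv v1]; split; [exact: isroot_refl | rewrite dot_refl].
Qed.

Lemma unit_root_delta i j : unit_root (delta_mx i j).
Proof. by split; [exact: isroot_delta | rewrite dot_delta mxE !eqxx]. Qed.

Lemma unit_root_permute_mx s t u : unit_root u -> unit_root (permute_mx s t u).
Proof. by move=> [ru u1]; split; [exact: isroot_permute_mx | rewrite dot_permute_mx]. Qed.

Lemma mixed_sqr_le x : N x ^+ 2 <= (n * m)%:R ^+ 2 * dot x x.
Proof.
have d0 := dot_ge0 x; have n0 : 0 <= N x by apply: is_norm_ge0; exact: mixed_is_norm.
have h : N x <= (n * m)%:R * Num.sqrt (dot x x).
  apply: le_trans (mixed_le_sum hN1 hN1n hN2 hN2n x) _.
  have -> : (n * m)%:R * Num.sqrt (dot x x) =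
      \sum_(j < n) \sum_(i < m) Num.sqrt (dot x x).
    by rewrite !sumr_const !card_ord -mulrnA mulnC mulr_natl.
  apply: ler_sum => j _; apply: ler_sum => i _.
  by rewrite -sqrtr_sqr ler_sqrt // sqr_entry_le.
rewrite -(sqr_sqrtr d0) -exprMn ler_sqr ?nnegrE // mulr_ge0 ?sqrtr_ge0 ?ler0n //.
Qed.

(** The reflection varies continuously with its normal, and the norm is
    continuous. *)
Lemma isroot_closed x : dot x x = 1 ->
  (forall eps, 0 < eps -> exists u, unit_root u /\ dot (u - x) (u - x) < eps) ->
  isroot N x.
Proof.
move=> x1 hx; split; first by rewrite -dot_eq0 x1 oner_eq0.
move=> y; apply/eqP; rewrite -subr_eq0 -sqrf_eq0 eq_le sqr_ge0 andbT.
set q := (_ ^+ 2); rewrite leNgt; apply/negP => q0.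
pose M := (n * m)%:R ^+ 2 * (16 * dot y y).
have M0 : 0 <= M by rewrite !mulr_ge0 ?sqr_ge0 ?dot_ge0.
have [u [[[_ ru] u1] ux]] : exists u, unit_root u /\ dot (u - x) (u - x) < q / (M + 1).
  by apply: hx; rewrite divr_gt0 // ltr_wpDl.
have h1 := is_norm_dist (mixed_is_norm hN1 hN2) (refl x y) (refl u y).
rewrite ru in h1.
have h2 : q <= N (refl x y - refl u y) ^+ 2.
  by rewrite /q -real_normK ?num_real // ler_sqr ?nnegrE // (le_trans (normr_ge0 _) h1).
have h3 := mixed_sqr_le (refl x y - refl u y).
have h4 := refl_lipschitz y x1 u1.
have h5 : dot (x - u) (x - u) = dot (u - x) (u - x) by rewrite -(opprB u x) dotNl dotNr opprK.
have h6 : q <= M * dot (u - x) (u - x).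
  apply: le_trans h2 (le_trans h3 _).
  have -> : M * dot (u - x) (u - x) =
      (n * m)%:R ^+ 2 * (16 * dot (x - u) (x - u) * dot y y) by rewrite h5 /M; ring.
  by apply: ler_wpM2l; [exact: sqr_ge0 | exact: h4].
rewrite ltr_pdivlMr ?ltr_wpDl // in ux.
have h7 := dot_ge0 (u - x); nra.
Qed.

(** The product of the reflections in [f] and in [c *: g + s *: f] rotates the
    plane of [f] and [g] by twice the angle between [g] and [c *: g + s *: f]. *)
Lemma isroot_rotate f g c s p r : unit_root f -> dot g g = 1 -> dot g f = 0 ->
  c ^+ 2 + s ^+ 2 = 1 -> isroot N (c *: g + s *: f) -> isroot N (p *: g + r *: f) ->
  isroot N ((p * (1 - 2 * s ^+ 2) - 2 * s * c * r) *: g +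
            (r * (1 - 2 * s ^+ 2) + 2 * s * c * p) *: f).
Proof.
move=> [rf f1] g1 gf cs ru ry.
have := isrootN (isroot_refl ru (isroot_refl rf ry)); congr isroot.
have u1 : dot (c *: g + s *: f) (c *: g + s *: f) = 1.
  by rewrite !dotE (dotC f g) gf g1 f1 -[RHS]cs; ring.
rewrite (refl_unit _ u1) (refl_unit _ f1).
apply/matrixP => i j; rewrite !dotE (dotC f g) gf g1 f1 !mxE.
apply/eqP; rewrite -subr_eq0.
rewrite [X in X == 0](_ : _ = 2 * p * g i j * (c ^+ 2 + s ^+ 2 - 1)); last ring.
by rewrite cs subrr mulr0.
Qed.

(** Rotate [c *: g + s *: f] repeatedly towards [f], by the same angle each time.
    The last root before the bisector of [g] and [f] is within one step of it. *)
Lemma isroot_near_bisector f g c s : unit_root f -> dot g g = 1 -> dot g f = 0 ->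
  c ^+ 2 + s ^+ 2 = 1 -> isroot N (c *: g + s *: f) -> 0 < s -> s < c ->
  exists p r, [/\ isroot N (p *: g + r *: f), p ^+ 2 + r ^+ 2 = 1,
    0 < r, 0 < p - r & p - r <= 4 * s].
Proof.
move=> rf g1 gf cs ru s0 sc; apply: contrapT => hno.
have c0 : 0 < c by apply: lt_trans sc.
have c1 : c <= 1 by nra.
(* A lower bound for the growth of the coefficient of f before the bisector. *)
pose del := s * (c - s); have del0 : 0 < del by rewrite mulr_gt0 // subr_gt0.
have hq (q : nat) : exists p r, [/\ isroot N (p *: g + r *: f), p ^+ 2 + r ^+ 2 = 1,
    0 < r, r < p & del *+ q <= r].
  elim: q => [|q [p [r [ry pr r0 rp hr]]]].
    by exists c, s; split => //; rewrite mulr0n ltW.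
  exists (p * (1 - 2 * s ^+ 2) - 2 * s * c * r), (r * (1 - 2 * s ^+ 2) + 2 * s * c * p).
  have p0 : 0 < p by apply: lt_trans rp.
  have p1 : p <= 1 by nra.
  have r1 : r <= 1 by nra.
  have p2 : 1 <= 2 * p by nra.
  have e : r * (1 - 2 * s ^+ 2) + 2 * s * c * p - r = 2 * s * (c * p - s * r) by ring.
  have e1 : (c - s) * p <= c * p - s * r by nra.
  have e2 : c - s <= 2 * (c * p - s * r) by nra.
  have e3 : del <= 2 * s * (c * p - s * r) by rewrite /del; nra.
  split.
  - exact: isroot_rotate.
  - have c2 : c ^+ 2 = 1 - s ^+ 2 by rewrite -cs addrK.
    transitivity ((p ^+ 2 + r ^+ 2) * ((1 - 2 * s ^+ 2) ^+ 2 + 4 * s ^+ 2 * c ^+ 2)).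
      ring.
    by rewrite pr c2; ring.
  - lra.
  - rewrite ltNge; apply/negP => hlt; apply: hno; exists p, r; split => //.
      by rewrite subr_gt0.
    have h1 : s * (p - r) + c * (p + r) <= 2.
      by have h2 := sqr_ge0 (s - (p - r)); have h3 := sqr_ge0 (c - (p + r)); nra.
    have h2 : 0 <= 2 * s * (2 - (s * (p - r) + c * (p + r))).
      by rewrite mulr_ge0 ?subr_ge0 // mulr_ge0 // ltW.
    lra.
  - rewrite mulrSr; lra.
have hb := archi_boundP (ltW (divr_gt0 (ltr01 : 0 < 1 :> R) del0)).
set q := Num.bound _ in hb; have [p [r [_ pr r0 rp hr]]] := hq q.
rewrite ltr_pdivrMr // mulr_natl in hb; nra.
Qed.

(** If unit roots with a nonzero component along [f] come arbitrarily close to [e],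
    then by [isroot_near_bisector] the bisector of [e] and [f] is a limit of roots;
    [e - f] is its reflection in [f]. *)
Lemma isroot_exchange e f : dot e e = 1 -> unit_root f -> dot e f = 0 ->
  (forall eps, 0 < eps -> exists u, [/\ unit_root u,
     dot (u - e) (u - e) < eps & dot u f != 0]) ->
  isroot N (e - f).
Proof.
move=> e1 rf ef hacc; have f1 := rf.2.
have c2 : Num.sqrt (2^-1 : R) ^+ 2 = 2^-1 by rewrite sqr_sqrtr // invr_ge0 ler0n.
pose c : R := Num.sqrt 2^-1; rewrite -/c in c2.
have c0 : 0 < c by rewrite sqrtr_gt0 invr_gt0 ltr0n.
suff : isroot N (c *: (e + f)).
  move/(isrootZ (invr_neq0 (lt0r_neq0 c0))); rewrite scalerA mulVf ?gt_eqF // scale1r.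
  move/(isroot_refl rf.1); rewrite linearD /= refl_self refl_orth //.
  by rewrite dotC.
apply: isroot_closed => [|eps eps0].
  by rewrite !dotE (dotC f e) ef e1 f1 -!mulrDr !mulrA -expr2 c2; field.
(* The new root is within squared distance 33 d of the bisector. *)
pose d := Num.min (100^-1) (eps / 100).
have d0 : 0 < d by rewrite lt_min invr_gt0 ltr0n divr_gt0.
have [d1 d2] : d <= 100^-1 /\ d <= eps / 100 by split; rewrite ge_min lexx ?orbT.
have [u [ru ue s0]] : exists u, [/\ unit_root u, dot (u - e) (u - e) < d & 0 < dot u f].
  have [u [ru ue s0]] := hacc d d0.
  have [s1|s1] := ltP 0 (dot u f); first by exists u.
  exists (refl f u); split; first exact: unit_root_refl.
    have -> : refl f u - e = refl f (u - e).
      by rewrite linearB /= (@refl_orth _ _ _ f e) // dotC.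
    by rewrite dot_refl.
  by rewrite dot_refl_swap refl_self dotNr oppr_gt0 lt_neqAle s0 s1.
have u1 := ru.2.
set s := dot u f in s0.
have s2 : s ^+ 2 < d.
  apply: le_lt_trans ue; have := cauchy_schwarz (u - e) f.
  by rewrite f1 mulr1 !dotE ef subr0.
have s3 : s < 10^-1 by nra.
pose a := Num.sqrt (1 - s ^+ 2).
have a2 : a ^+ 2 = 1 - s ^+ 2 by rewrite sqr_sqrtr; nra.
have a0 : 0 < a by rewrite sqrtr_gt0; nra.
have a1 : a <= 1 by nra.
have sa : s < a by nra.
pose g := a^-1 *: (u - s *: f).
have g1 : dot g g = 1.
  rewrite !dotE (dotC f u) -/s u1 f1.
  rewrite [LHS](_ : _ = (1 - s ^+ 2) / a ^+ 2).
    by rewrite -a2 divff // expf_neq0 // gt_eqF.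
  by field; rewrite gt_eqF.
have gf : dot g f = 0 by rewrite !dotE -/s f1; ring.
have ge : dot (g - e) (g - e) <= dot (u - e) (u - e).
  have gE : dot g e = a^-1 * dot u e.
    by rewrite /g dotZl dotDl dotNl dotZl (dotC f e) ef mulr0 subr0.
  have ueE : dot (u - e) (u - e) = 2 - 2 * dot u e.
    by rewrite !dotE (dotC e u) u1 e1; ring.
  have -> : dot (g - e) (g - e) = 2 - 2 * dot g e.
    by rewrite !(dotDl, dotDr, dotNl, dotNr) (dotC e g) g1 e1; ring.
  have aV : 1 <= a^-1 by rewrite invf_ge1.
  have ue0 : 0 <= dot u e by rewrite ueE in ue; lra.
  rewrite ueE gE; nra.
have ug : u = a *: g + s *: f.
  by rewrite /g scalerA mulfV ?gt_eqF // scale1r subrK.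
clearbody g.
have as1 : a ^+ 2 + s ^+ 2 = 1 by rewrite a2 subrK.
have ru' := ru.1; rewrite ug in ru'.
have [p [r [ry pr r0 pr0 prs]]] := isroot_near_bisector rf g1 gf as1 ru' s0 sa.
exists (p *: g + r *: f); split.
  by split => //; rewrite !dotE (dotC f g) gf g1 f1 -[RHS]pr; ring.
have -> : p *: g + r *: f - c *: (e + f) = (p *: g + r *: f - c *: (g + f)) + c *: (g - e).
  by apply/matrixP => i j; rewrite !mxE; ring.
apply: le_lt_trans (dot_addsqr_le _ _) _.
have -> : dot (c *: (g - e)) (c *: (g - e)) = 2^-1 * dot (g - e) (g - e).
  by rewrite -c2 expr2 -mulrA dotZl dotZr.
have h : dot (p *: g + r *: f - c *: (g + f)) (p *: g + r *: f - c *: (g + f)) <= 16 * s ^+ 2.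
  have -> : dot (p *: g + r *: f - c *: (g + f)) (p *: g + r *: f - c *: (g + f)) =
      (p ^+ 2 + r ^+ 2) + 2 * c ^+ 2 - 2 * c * (p + r).
    by rewrite !(dotDl, dotDr, dotNl, dotNr, dotZl, dotZr) (dotC f g) g1 f1 gf; ring.
  pose X := 2 * c * (p + r).
  have X2 : X ^+ 2 = 4 - 2 * (p - r) ^+ 2.
    rewrite (_ : X ^+ 2 = 4 * c ^+ 2 * (2 * (p ^+ 2 + r ^+ 2) - (p - r) ^+ 2)).
      by rewrite c2 pr; field.
    by rewrite /X; ring.
  have X0 : 0 <= X by rewrite /X !mulr_ge0 ?(ltW c0) //; lra.
  have pr2 : (p - r) ^+ 2 <= 16 * s ^+ 2 by nra.
  rewrite pr c2 -/X; have := sqr_ge0 (p - r); nra.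
lra.
Qed.
End Accumulating.

(** * Coordinate vectors are isolated unit roots *)

Section Finiteness.
Variables (R : realType) (m n : nat) (N1 : 'cV[R]_n -> R) (N2 : 'cV[R]_m -> R).
Hypotheses (hN1 : symmetric_norm N1) (hN1n : normalized N1).
Hypotheses (hN2 : symmetric_norm N2) (hN2n : normalized N2).
Local Notation N := (mixed_norm N1 N2).
Local Notation V := 'M[R]_(m, n).
Local Notation K := ('I_m * 'I_n)%type.
Local Notation E := (fun k : K => delta_mx k.1 k.2 : V).
Local Notation unit_root := (@unit_root R m n N1 N2).
Implicit Types (u v w x y : V).

Definition cross u :=
  exists i j i' j', [/\ j != j', u i j != 0 & u i' j' != 0].

Lemma isroot_normalize v : isroot N v ->
  exists2 c, 0 < c & unit_root (c *: v) /\ c ^+ 2 * dot v v = 1.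
Proof.
move=> rv; have v0 : 0 < dot v v by rewrite dot_gt0; case: rv.
have s0 : 0 < Num.sqrt (dot v v) by rewrite sqrtr_gt0.
have h : (Num.sqrt (dot v v))^-1 ^+ 2 * dot v v = 1.
  by rewrite -{2}(sqr_sqrtr (ltW v0)) -exprMn mulVf ?gt_eqF // expr1n.
exists (Num.sqrt (dot v v))^-1; first by rewrite invr_gt0.
split=> //; split; first by apply: isrootZ => //; rewrite invr_neq0 ?gt_eqF.
by rewrite dotZl dotZr mulrA -expr2.
Qed.

Lemma finite_eps (I : finType) (P : I -> R -> Prop) :
  (forall i, exists eps, 0 < eps /\ P i eps) ->
  (forall i a b, a <= b -> P i b -> P i a) ->
  exists eps, 0 < eps /\ forall i, P i eps.
Proof.
move=> hP hmono.
suff h (s : seq I) : exists eps, 0 < eps /\ forall i, i \in s -> P i eps.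
  have [eps [e0 he]] := h (enum I); exists eps; split=> // i.
  by apply: he; rewrite mem_enum.
elim: s => [|i s [a [a0 ha]]]; first by exists 1; split => //.
have [b [b0 hb]] := hP i; exists (Num.min a b); split; first by rewrite lt_min a0.
move=> i'; rewrite in_cons => /orP[/eqP ->|hi'].
  by apply: hmono hb; rewrite ge_min lexx orbT.
by apply: hmono (ha _ hi'); rewrite ge_min lexx.
Qed.

(** Only finitely many values are compared, since [g] factors through [C]. *)
Lemma finite_min (T : Type) (F : finType) (C : T -> F) (P : T -> Prop) (g : T -> R) :
  (forall t t', P t -> P t' -> C t = C t' -> g t = g t') ->
  (exists t, P t) -> exists t, P t /\ forall t', P t' -> g t <= g t'.
Proof.
move=> hg [t0 Pt0].
pose f c := match pselect (exists t, P t /\ C t = c) with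
  | left e => projT1 (cid e) | right _ => t0 end.
have hf c : (exists t, P t /\ C t = c) -> P (f c) /\ C (f c) = c.
  by rewrite /f; case: pselect => // e _; exact: (projT2 (cid e)).
pose A c := `[< exists t, P t /\ C t = c >].
have A0 : A (C t0) by apply/asboolP; exists t0.
case: (@Order.TotalTheory.arg_minP _ _ _ (C t0) A (g \o f) A0) => c /asboolP hc hmin.
have [Pf Cf] := hf c hc; exists (f c); split=> // t Pt.
have hCt : exists t', P t' /\ C t' = C t by exists t.
have [Pft Cft] := hf _ hCt; rewrite -(hg _ _ Pft Pt Cft).
by apply: hmin; apply/asboolP.
Qed.

Hypothesis no_exchange : forall i j i' j', j != j' ->
  ~ isroot N (delta_mx i j - delta_mx i' j').

Lemma dot_deltas i j i' j' :
  dot (delta_mx i j : V) (delta_mx i' j') = ((i' == i) && (j' == j))%:R.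
Proof. by rewrite dot_delta mxE. Qed.

(** Otherwise [isroot_exchange] produces an excluded root. *)
Lemma column_isolated : exists eps, 0 < eps /\
  forall i j i' j', j != j' -> forall u, unit_root u ->
    dot (u - delta_mx i j) (u - delta_mx i j) < eps -> u i' j' = 0.
Proof.
have [|i a b ab h jj u ru hu|eps [e0 h]] := @finite_eps
  (K * K)%type (fun k eps => k.1.2 != k.2.2 -> forall u, unit_root u ->
    dot (u - E k.1) (u - E k.1) < eps -> u k.2.1 k.2.2 = 0).
- move=> [[i j] [i' j']] /=.
  have [->|jj] := eqVneq j j'; first by exists 1; split.
  apply: contrapT => hno; apply: (no_exchange (i := i) (i' := i') jj).
  apply: isroot_exchange => //.
  + by rewrite dot_deltas !eqxx.
  + exact: unit_root_delta.
  + by rewrite dot_deltas [j' == j]eq_sym (negbTE jj) andbF.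
  move=> eps e0; apply: contrapT => hno'; apply: hno; exists eps; split=> // _ u ru hu.
  apply: contrapT => /eqP u0; apply: hno'; exists u; split=> //.
  by rewrite dot_delta.
- by apply: h => //; apply: lt_le_trans ab.
exists eps; split=> // i j i' j' jj; exact: (h ((i, j), (i', j'))).
Qed.

(** By [column_isolated] a unit root [u] near [d = delta_mx i j] lies in column
    [j]; by symmetry, [(i, j)] may be taken to be a nonzero entry of [v].  The small
    rotation generated by [d] and [u] takes [v] to a root [v'] near [v], which
    differs from [v] only in column [j].  Then [refl v' (refl v l)] is a unit root
    near the coordinate vector [l] of another column, so it vanishes in column [j].
    This forces [v' = v], and hence [u = d], since [v] is not orthogonal to [d]. *)
Lemma delta_isolated v : isroot N v -> cross v -> exists eps, 0 < eps /\
  forall i j u, unit_root u -> dot (u - delta_mx i j) (u - delta_mx i j) < eps ->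
    u = delta_mx i j.
Proof.
move=> /isroot_normalize[c c0 [rv _]] [i [j [i' [j' [jj vij vij']]]]].
have {}vij : (c *: v) i j != 0 by rewrite mxE mulf_neq0 // lt0r_neq0.
have {}vij' : (c *: v) i' j' != 0 by rewrite mxE mulf_neq0 // lt0r_neq0.
move: (c *: v) rv vij vij' => {c0}{}v rv vij vij'.
have [eps0 [e0 hcol]] := column_isolated.
(* Two applications of the Lipschitz bound give 256; 1 / 16 keeps v' and v closer
   than 1. *)
pose eps := Num.min (eps0 / 256) (16^-1).
have eps_gt0 : 0 < eps by rewrite lt_min divr_gt0 //= invr_gt0.
have [eps1 eps2] : eps <= eps0 / 256 /\ eps <= 16^-1.
  by split; rewrite ge_min lexx ?orbT.
exists eps; split => // i1 j1 u1 ru1 hu1.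
pose u := permute_mx (tperm i i1) (tperm j j1) u1.
have prmd : permute_mx (tperm i i1) (tperm j j1) (delta_mx i1 j1) = delta_mx i j :> V.
  apply/matrixP => p q; rewrite !mxE.
  rewrite -{2}(tpermL i i1) -{2}(tpermL j j1) !(inj_eq perm_inj) //.
have ru : unit_root u by exact: unit_root_permute_mx.
have hu : dot (u - delta_mx i j) (u - delta_mx i j) < eps.
  by rewrite -prmd -linearB dot_permute_mx.
suff : u = delta_mx i j.
  rewrite -prmd => /(congr1 (permute_mx (tperm i i1)^-1%g (tperm j j1)^-1%g)).
  by move=> /matrixP h; apply/matrixP => p q; have := h p q; rewrite !mxE !permKV.
move: u ru hu => {u1 ru1 hu1 prmd} u ru hu.
have ucol p q : q != j -> u p q = 0.
  move=> qj; apply: (hcol i j) => //; first by rewrite eq_sym.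
  by apply: (lt_le_trans hu); apply: (le_trans eps1); rewrite ler_pdivrMr //; lra.
have u1 := ru.2; have v1 := rv.2.
pose d : V := delta_mx i j; pose l : V := delta_mx i' j'.
have rd : unit_root d by exact: unit_root_delta.
have rl : unit_root l by exact: unit_root_delta.
have d1 := rd.2; have l1 := rl.2.
pose a := v i j; pose b := dot u (refl d v).
pose q := a *: d + b *: u.
pose v' := refl u (refl d v).
have v'E : v' = v - 2 *: q.
  rewrite /v' (refl_unit _ u1) -/b (refl_unit _ d1) [dot d v]dotC dot_delta -/a.
  by rewrite /q; apply/matrixP => s t; rewrite !mxE; ring.
have qcol p t : t != j -> q p t = 0.
  by move=> tj; rewrite !mxE (negbTE tj) andbF mulr0 add0r ucol // mulr0.
have qE : q = a *: d + b *: u by [].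
clearbody q.
have rv' : unit_root v' by apply: unit_root_refl => //; apply: unit_root_refl.
have v'1 := rv'.2.
have hvv' : dot (v' - v) (v' - v) < 16 * eps.
  have h := refl_lipschitz (refl d v) u1 d1.
  rewrite reflK dot_refl v1 mulr1 in h; apply: le_lt_trans h _.
  by rewrite ltr_pM2l.
pose x := refl v l; pose vl := v i' j'.
have x1 : dot x x = 1 by rewrite dot_refl.
have xl : refl v x = l by rewrite reflK.
have xE : x = l - (2 * vl) *: v by rewrite /x (refl_unit _ v1) dot_delta.
clearbody x.
pose w := refl v' x.
have rw : unit_root w by apply: unit_root_refl => //; split; [|exact: x1];
  rewrite -[x](reflK v) xl; apply: (isroot_refl rv.1 rl.1).
have hw : dot (w - l) (w - l) < eps0.
  have h := refl_lipschitz x v'1 v1.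
  rewrite xl x1 mulr1 in h; apply: le_lt_trans h _.
  lra.
have wcol p : w p j = 0.
  by apply: (hcol i' j') => //; rewrite eq_sym.
pose t := dot v q.
have lq : dot l q = 0 by rewrite dotC dot_delta qcol // eq_sym.
have qq : dot q q = t.
  have : dot v' v' = dot v v by rewrite v1.
  by rewrite v'E !dotE (dotC q v) -/t; lra.
have g : dot v' x = - vl + 4 * vl * t.
  rewrite v'E xE !dotE v1 dot_delta (dotC q l) lq (dotC q v) -/vl -/t; ring.
clearbody v'.
have key : dot ((2 * t) *: v) q = dot ((4 * t - 1) *: q) q.
  apply: eq_bigr => p _; apply: eq_bigr => s _.
  have [->|sj] := eqVneq s j; last by rewrite qcol // !mulr0.
  have := wcol p; rewrite /w (refl_unit _ v'1) g v'E {1}xE !mxE (negbTE jj) andbF mulr0n => h.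
  have h2 : 2 * vl * (2 * t * v p j - (4 * t - 1) * q p j) = 0.
    by rewrite -[RHS](mulr0 (- 2^-1)) -h; field.
  have {}h2 : 2 * t * v p j = (4 * t - 1) * q p j.
    have vl0 : 2 * vl != 0 by rewrite mulf_neq0 // pnatr_eq0.
    by move/eqP: h2; rewrite mulf_eq0 (negbTE vl0) /= subr_eq0 => /eqP.
  by rewrite h2.
rewrite !dotZl qq -/t in key.
(* If t were not 0, then t would be 1/2 and v' would be too far from v. *)
have t0 : t = 0.
  have [//|t0] := eqVneq t 0.
  have t12 : t = 2^-1 by apply: (mulfI t0); move: key; lra.
  have : dot (v' - v) (v' - v) = 2.
    have -> : v' - v = (- 2) *: q by rewrite v'E addrAC subrr add0r scaleNr.
    by rewrite dotZl dotZr qq t12; field.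
  lra.
have q0 : q = 0 by apply/eqP; rewrite -dot_eq0 qq t0.
have a0 : a != 0 by [].
have bd : b *: u = - a *: d by rewrite scaleNr; apply/eqP; rewrite -addr_eq0 addrC -qE q0.
have b0 : b != 0.
  apply: contra a0 => /eqP b0; have := congr1 (dot d) bd.
  by rewrite b0 scale0r dot0r dotZr d1 mulr1 => /esym/eqP; rewrite oppr_eq0.
have ud : u = (- a / b) *: d.
  by apply: (scalerI b0); rewrite bd scalerA; congr (_ *: _); field.
have c2 : (- a / b) ^+ 2 = 1.
  by rewrite -u1 ud dotZl dotZr d1; ring.
rewrite ud; have /eqP := c2; rewrite sqrf_eq1 => /orP[/eqP->|/eqP cN]; first by rewrite scale1r.
have : dot (u - d) (u - d) = 4.
  by rewrite ud cN scaleN1r !dotE d1; ring.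
by move=> h; exfalso; move: hu; rewrite -/d h; lra.
Qed.
End Finiteness.

(** * Lowest roots *)

Section LowestRoot.
Variables (R : realType) (m n : nat) (N1 : 'cV[R]_n -> R) (N2 : 'cV[R]_m -> R).
Hypotheses (hN1 : symmetric_norm N1) (hN1n : normalized N1).
Hypotheses (hN2 : symmetric_norm N2) (hN2n : normalized N2).
Local Notation N := (mixed_norm N1 N2).
Local Notation V := 'M[R]_(m, n).
Local Notation K := ('I_m * 'I_n)%type.
Local Notation unit_root := (@unit_root R m n N1 N2).
Implicit Types (u v w x y e : V).

Hypothesis isolated : exists eps, 0 < eps /\
  forall i j u, unit_root u -> dot (u - delta_mx i j) (u - delta_mx i j) < eps ->
    u = delta_mx i j.

(** Isolation makes the unit roots finite up to sign.  If [u] and [u'] lie in the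
    same cell of a fine grid, then the product of their reflections moves each
    coordinate vector to a nearby unit root, so it fixes them all. *)
Lemma finitely_many_roots : exists (F : finType) (C : V -> F), forall u u',
  unit_root u -> unit_root u' -> C u = C u' -> forall w, dot u w ^+ 2 = dot u' w ^+ 2.
Proof.
have [eps [e0 hiso]] := isolated.
(* The grid has M cells per unit length. *)
pose M := (Num.bound (16 * (m * n)%:R / eps)).+1.
have M0 : 0 < M%:R :> R by rewrite ltr0n.
have M1 : 1 <= M%:R :> R by rewrite ler1n.
have hM : 16 * (m * n)%:R < eps * M%:R.
  have h0 : 0 <= 16 * (m * n)%:R / eps by rewrite divr_ge0 ?mulr_ge0 ?ler0n // ltW.
  have := archi_boundP h0; rewrite ltr_pdivrMr // => h.
  by apply: lt_le_trans h _; rewrite mulrC ler_pM2l // ler_nat.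
pose C u := [ffun k : K => inord (Num.truncn ((u k.1 k.2 + 1) * M%:R)) : 'I_(2 * M).+1].
exists {ffun K -> 'I_(2 * M).+1}, C => u u' ru ru' hC.
have u1 := ru.2; have u'1 := ru'.2.
have entry x (k : K) : dot x x = 1 -> -1 <= x k.1 k.2 <= 1.
  move=> x1; have := sqr_entry_le x k.1 k.2.
  by rewrite x1 => h; apply/andP; split; nra.
have grid x (k : K) : dot x x = 1 ->
    let q := Num.truncn ((x k.1 k.2 + 1) * M%:R) in
    (q < (2 * M).+1)%N /\ q%:R <= (x k.1 k.2 + 1) * M%:R < q.+1%:R.
  move=> x1 q; have /andP[h1 h2] := entry x k x1.
  have h0 : 0 <= (x k.1 k.2 + 1) * M%:R by rewrite mulr_ge0 ?ler0n //; lra.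
  split; last exact: truncn_itv.
  rewrite ltnS -(ler_nat R) natrM; have /andP[h _] := truncn_itv h0.
  by apply: le_trans h _; rewrite ler_pM2r //; lra.
have close i j : (u' i j - u i j) ^+ 2 * M%:R <= 1.
  have [q1 /andP[]] := grid u (i, j) u1; have [q2 /andP[]] := grid u' (i, j) u'1.
  move/ffunP/(_ (i, j)): hC; rewrite !ffunE /= => /(congr1 val) /=.
  rewrite !inordK // => ->; set q := Num.truncn _; rewrite -natr1 => a1 a2 a3 a4.
  have h : -1 <= (u' i j - u i j) * M%:R <= 1 by apply/andP; split; lra.
  have h2 : ((u' i j - u i j) * M%:R) ^+ 2 <= 1 by nra.
  apply: le_trans h2; rewrite exprMn ler_wpM2l ?sqr_ge0 // expr2 ler_peMr // ltW //.
have huu : 16 * dot (u' - u) (u' - u) < eps.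
  rewrite -(ltr_pM2r M0); apply: le_lt_trans hM; rewrite -mulrA ler_pM2l //.
  have -> : (m * n)%:R = \sum_(i < m) \sum_(j < n) (1 : R).
    by rewrite !sumr_const !card_ord -mulrnA mulnC.
  rewrite /dot mulr_suml; apply: ler_sum => i _; rewrite mulr_suml.
  by apply: ler_sum => j _; rewrite -expr2 !mxE.
have hd i j : refl u (delta_mx i j) = refl u' (delta_mx i j).
  have rd : unit_root (delta_mx i j) by exact: unit_root_delta.
  have hfix : refl u' (refl u (delta_mx i j)) = delta_mx i j.
    apply: hiso; first by apply: unit_root_refl => //; exact: unit_root_refl.
    have h := refl_lipschitz (refl u (delta_mx i j)) u'1 u1.
    by rewrite reflK dot_refl rd.2 mulr1 in h; apply: le_lt_trans h _.
  by rewrite -[LHS](reflK u') hfix.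
have hr w : refl u w = refl u' w.
  by apply/matrixP => i j; rewrite -!dot_delta !dot_refl_swap hd.
move=> w; have := congr1 (dot w) (hr w).
rewrite !refl_unit // !dotE (dotC w u) (dotC w u'); lra.
Qed.

Lemma lowest_root (P : V -> Prop) w : (forall u, P u -> unit_root u) ->
  (exists u, P u) -> exists u, P u /\ forall u', P u' -> dot u w ^+ 2 <= dot u' w ^+ 2.
Proof.
move=> hP exP; have [F [C hC]] := finitely_many_roots.
by apply: (finite_min (C := C) (g := fun u => dot u w ^+ 2)) => // u u' Pu Pu' /hC; apply; exact: hP.
Qed.

(** The height of a root is its component along [w]; [e] has height 0.  Reflecting
    [e] in [u], and [u] in [e] and then in itself, produces roots whose heights
    relative to [u] are, up to sign, [2 * t] and [4 * t ^+ 2 - 1], where [t] is the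
    cosine of the angle of [u] and [e].  These are zero or at least 1 in absolute
    value, which leaves for the square [t2] of [t] the values stated. *)
Lemma lowest_root_angle (P : V -> Prop) w u e :
  (forall u', P u' -> dot u w ^+ 2 <= dot u' w ^+ 2) ->
  unit_root u -> dot u w != 0 -> isroot N e -> dot e w = 0 ->
  (forall a b, unit_root (a *: u + b *: e) -> a != 0 -> P (a *: u + b *: e)) ->
  let t2 := dot u e ^+ 2 / dot e e in t2 = 0 \/ 4 * t2 = 1 \/ 1 <= 2 * t2.
Proof.
move=> hmin ru uw0 /isroot_normalize[c c0 [re c2]] ew hP t2.
have ee : 0 < dot e e by move: c2; have := dot_ge0 e; nra.
pose f := c *: e; rewrite -/f in re; have f1 := re.2; have u1 := ru.2.
have fw : dot f w = 0 by rewrite dotZl ew mulr0.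
pose t := dot u f.
have tE : t2 = t ^+ 2.
  rewrite /t2 /t dotZr exprMn [c ^+ 2](_ : _ = (dot e e)^-1); first by rewrite mulrC.
  by apply: (mulIf (lt0r_neq0 ee)); rewrite c2 mulVf ?gt_eqF.
have uw : 0 < dot u w ^+ 2 by rewrite exprn_even_gt0.
have heights a b : unit_root (a *: u + b *: f) -> a != 0 -> 1 <= a ^+ 2.
  move=> rab a0; rewrite scalerA in rab; have := hmin _ (hP _ _ rab a0).
  by rewrite dotDl !dotZl ew mulr0 addr0 exprMn ler_pMl.
clearbody f.
have h1 : t != 0 -> 1 <= 4 * t ^+ 2.
  move=> t0; have := heights (- 2 * t) 1; rewrite scale1r exprMn sqrrN -natrX; apply.
    have -> : (- 2 * t) *: u + f = refl u f.
      by rewrite (refl_unit _ u1) -/t mulNr scaleNr addrC.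
    exact: unit_root_refl.
  by rewrite mulf_neq0 // oppr_eq0 pnatr_eq0.
have h2 : 4 * t ^+ 2 - 1 != 0 -> 1 <= (4 * t ^+ 2 - 1) ^+ 2.
  move=> t0; apply: (heights _ (- 2 * t)) => //.
  have -> : (4 * t ^+ 2 - 1) *: u + (- 2 * t) *: f = refl u (refl f u).
    rewrite (refl_unit _ u1) (refl_unit _ f1) !dotE u1 (dotC f u) -/t.
    by apply/matrixP => i j; rewrite !mxE; ring.
  by apply: unit_root_refl => //; exact: unit_root_refl.
rewrite tE; have [->|t0] := eqVneq t 0; first by left; rewrite expr0n.
have [h|t4] := eqVneq (4 * t ^+ 2 - 1) 0; first by right; left; lra.
right; right; have := h1 t0; have := h2 t4; nra.
Qed.
End LowestRoot.

(** * Removing two entries of a root *)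

(** For the inner products [x], [y] of a unit vector with two orthonormal vectors,
    the hypotheses restrict the angles with these two and with their sum and
    difference.  They leave only projections of length [sqrt (1 / 2)] to the plane,
    along one of these four directions. *)
Lemma two_cosines (R : realFieldType) (x y : R) :
  let allowed t := t = 0 \/ 4 * t = 1 \/ 1 <= 2 * t in
  allowed (x ^+ 2) -> allowed (y ^+ 2) ->
  allowed ((x + y) ^+ 2 / 2) -> allowed ((x - y) ^+ 2 / 2) ->
  0 < x ^+ 2 + y ^+ 2 < 1 ->
  [\/ y = 0 /\ 2 * x ^+ 2 = 1, x = 0 /\ 2 * y ^+ 2 = 1 |
      exists b : bool, y = (-1) ^+ b * x /\ 4 * x ^+ 2 = 1].
Proof.
move=> allowed hx hy hp hm /andP[h0 h1].
have [x0|x0] := eqVneq x 0.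
  constructor 2; split=> //; rewrite x0 in hp h0 h1.
  by case: hp => [h|[h|h]]; lra.
have [y0|y0] := eqVneq y 0.
  constructor 1; split=> //; rewrite y0 in hp h0 h1.
  by case: hp => [h|[h|h]]; lra.
constructor 3.
have x2 : x ^+ 2 != 0 by rewrite sqrf_eq0.
have y2 : y ^+ 2 != 0 by rewrite sqrf_eq0.
have {}hx : 4 * x ^+ 2 = 1 \/ 1 <= 2 * x ^+ 2 by case: hx => // /eqP; rewrite (negbTE x2).
have {}hy : 4 * y ^+ 2 = 1 \/ 1 <= 2 * y ^+ 2 by case: hy => // /eqP; rewrite (negbTE y2).
have x3 : 1 <= 4 * x ^+ 2 by lra.
have y3 : 1 <= 4 * y ^+ 2 by lra.
have xy : 1 <= 16 * (x * y) ^+ 2 by nra.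
have hb : exists b : bool, y = (-1) ^+ b * x.
  have [xy0|xy0] := leP 0 (x * y).
    exists false; rewrite expr0 mul1r; have xy1 : 1 <= 4 * (x * y) by nra.
    case: hm => [h|[h|h]]; [|by lra|by lra].
    have /eqP : (x - y) ^+ 2 = 0 by lra.
    by rewrite sqrf_eq0 subr_eq0 => /eqP.
  exists true; rewrite expr1 mulN1r; have xy1 : 4 * (x * y) <= - 1 by nra.
  case: hp => [h|[h|h]]; [|by lra|by lra].
  have /eqP : (x + y) ^+ 2 = 0 by lra.
  by rewrite sqrf_eq0 addrC addr_eq0 => /eqP.
have [b yx] := hb; exists b; split=> //.
have yx2 : y ^+ 2 = x ^+ 2 by rewrite yx exprMn sqrr_sign mul1r.
by case: hx => // h; lra.
Qed.

(** With a projection [(x, y)] of that kind, the directions [(p, q)] at an allowed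
    angle are again only the two axes and the two diagonals. *)
Lemma four_lines (R : realFieldType) (x y p q : R) : 0 < p ^+ 2 + q ^+ 2 ->
  [\/ y = 0 /\ 2 * x ^+ 2 = 1, x = 0 /\ 2 * y ^+ 2 = 1 |
      exists b : bool, y = (-1) ^+ b * x /\ 4 * x ^+ 2 = 1] ->
  let t := (x * p + y * q) ^+ 2 / (p ^+ 2 + q ^+ 2) in
  t = 0 \/ 4 * t = 1 \/ 1 <= 2 * t ->
  [\/ p = 0, q = 0 | exists b : bool, q = (-1) ^+ b * p].
Proof.
move=> pq0 cases t; have tE : t * (p ^+ 2 + q ^+ 2) = (x * p + y * q) ^+ 2.
  by rewrite divfK // gt_eqF.
have hsq : p ^+ 2 = q ^+ 2 -> exists b : bool, q = (-1) ^+ b * p.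
  move/eqP; rewrite eqf_sqr => /orP[/eqP ->|/eqP ->]; first by exists false; rewrite mul1r.
  by exists true; rewrite expr1 mulN1r opprK.
have hz (r : R) : r ^+ 2 <= 0 -> r = 0.
  by move=> r0; apply/eqP; rewrite -sqrf_eq0 eq_le r0 sqr_ge0.
have p2 := sqr_ge0 p; have q2 := sqr_ge0 q.
case: cases => [[y0 x2]|[x0 y2]|[s [ys x2]]].
+ have xp : 2 * (x * p + y * q) ^+ 2 = p ^+ 2 by rewrite y0 mul0r addr0 exprMn mulrA x2 mul1r.
  case=> [t0|[t4|t2]].
  * by constructor 1; apply: hz; rewrite -xp -tE t0 mul0r mulr0.
  * by constructor 3; apply: hsq; nra.
  * by constructor 2; apply: hz; nra.
+ have xp : 2 * (x * p + y * q) ^+ 2 = q ^+ 2 by rewrite x0 mul0r add0r exprMn mulrA y2 mul1r.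
  case=> [t0|[t4|t2]].
  * by constructor 2; apply: hz; rewrite -xp -tE t0 mul0r mulr0.
  * by constructor 3; apply: hsq; nra.
  * by constructor 1; apply: hz; nra.
+ have s2 : ((-1) ^+ s : R) ^+ 2 = 1 by rewrite sqrr_sign.
  move: ((-1) ^+ s : R) s2 ys => sg s2 ys.
  have xp : 4 * (x * p + y * q) ^+ 2 = (p + sg * q) ^+ 2.
    rewrite ys (_ : x * p + sg * x * q = x * (p + sg * q)); last by ring.
    by rewrite exprMn mulrA x2 mul1r.
  have xp' : (p + sg * q) ^+ 2 = p ^+ 2 + q ^+ 2 + 2 * (p * (sg * q)).
    by rewrite sqrrD exprMn s2 mul1r; ring.
  case=> [t0|[t4|t2]].
  * constructor 3; apply: hsq.
    have h : p + sg * q = 0 by apply: hz; rewrite -xp -tE t0 mul0r mulr0.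
    by move/eqP: h; rewrite addr_eq0 => /eqP ->; rewrite sqrrN exprMn s2 mul1r.
  * have : p * (sg * q) = 0 by nra.
    move/eqP; rewrite !mulf_eq0 => /or3P[/eqP p0|/eqP s0|/eqP q0].
    - by constructor 1.
    - by move: s2; rewrite s0 expr0n /=; lra.
    - by constructor 2.
  * constructor 3; apply: hsq.
    have h : p - sg * q = 0.
      by apply: hz; rewrite sqrrB exprMn s2 mul1r; nra.
    by move/eqP: h; rewrite subr_eq0 => /eqP ->; rewrite exprMn s2 mul1r.
Qed.

Lemma neq0_of_mulsqr (R : realFieldType) (c x : R) : c * x ^+ 2 = 1 -> x != 0.
Proof.
by move=> h; apply/eqP => x0; move/eqP: h; rewrite x0 expr0n mulr0 eq_sym oner_eq0.
Qed.

Section Reduction.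
Variables (R : realType) (m n : nat) (N1 : 'cV[R]_n -> R) (N2 : 'cV[R]_m -> R).
Hypotheses (hN1 : symmetric_norm N1) (hN1n : normalized N1).
Hypotheses (hN2 : symmetric_norm N2) (hN2n : normalized N2).
Local Notation N := (mixed_norm N1 N2).
Local Notation V := 'M[R]_(m, n).
Local Notation unit_root := (@unit_root R m n N1 N2).
Implicit Types (u v w x y e : V).

Hypothesis isolated : exists eps, 0 < eps /\
  forall i j u, unit_root u -> dot (u - delta_mx i j) (u - delta_mx i j) < eps ->
    u = delta_mx i j.

(** Up to scaling, the roots of the dihedral group of order 8 which acts on the
    coordinates [i] and [i']. *)
Definition axis_or_diagonal (i i' : 'I_m) (y : 'cV[R]_m) :=
  [\/ y = delta_mx i 0, y = delta_mx i' 0 |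
      exists b : bool, y = delta_mx i 0 + (-1) ^+ b *: delta_mx i' 0].

Lemma isroot_axis_or_diagonal i i' j (y : 'cV[R]_m) : i != i' -> axis_or_diagonal i i' y -> isroot N (at_col j y).
Proof.
move=> ii [->|->|[b ->]].
- by rewrite at_col_delta; exact: isroot_delta.
- by rewrite at_col_delta; exact: isroot_delta.
rewrite linearD linearZ /= !at_col_delta.
case: b; rewrite ?expr1 ?expr0; first by rewrite scaleN1r; exact: isroot_deltaB.
by rewrite scale1r; exact: isroot_deltaD.
Qed.

(** Among the unit roots in the space spanned by the two coordinate vectors and [w]
    take a lowest one above the coordinate plane.  By [lowest_root_angle] and
    [two_cosines] it projects to an axis or a diagonal of the plane, at an angle of
    45 degrees, so that reflecting this projection, which is a root, gives a multiple
    of [w].  The roots of the plane satisfy the same angle condition, hence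
    [four_lines]. *)
Lemma isroot_prism i i' j w a b : i != i' -> w i j = 0 -> w i' j = 0 -> w != 0 ->
  isroot N (a *: delta_mx i j + b *: delta_mx i' j + w) -> a != 0 ->
  [/\ exists (y : 'cV[R]_m) z, [/\ axis_or_diagonal i i' y, isroot N (at_col j y + z *: w) &
                      dot y y = z ^+ 2 * dot w w],
      isroot N w &
      forall p q, isroot N (p *: delta_mx i j + q *: delta_mx i' j) ->
        [\/ p = 0, q = 0 | exists b : bool, q = (-1) ^+ b * p]].
Proof.
move=> ii wi wi' w0 rv a0.
pose d : V := delta_mx i j; pose d' : V := delta_mx i' j.
have dd : dot d d = 1 by rewrite dot_deltas !eqxx.
have d'd' : dot d' d' = 1 by rewrite dot_deltas !eqxx.
have dd' : dot d d' = 0 by rewrite dot_deltas eq_sym (negbTE ii).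
have dw : dot d w = 0 by rewrite dotC dot_delta.
have d'w : dot d' w = 0 by rewrite dotC dot_delta.
rewrite -/d -/d' in rv *.
have rd : isroot N d by exact: isroot_delta.
have rd' : isroot N d' by exact: isroot_delta.
have rp : isroot N (d + d') by exact: isroot_deltaD.
have rm : isroot N (d - d') by exact: isroot_deltaB.
have dE (y : 'cV[R]_m) : axis_or_diagonal i i' y -> dot y y = dot (at_col j y) (at_col j y).
  by rewrite dot_at_col col_at_col eqxx.
have dAt : at_col j (delta_mx i 0) = d by rewrite at_col_delta.
have dAt' : at_col j (delta_mx i' 0) = d' by rewrite at_col_delta.
clearbody d d'.
pose om := dot w w; have om0 : 0 < om by rewrite dot_gt0.
pose P u := [/\ unit_root u, dot u w != 0 & exists x y z : R, u = x *: d + y *: d' + z *: w].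
have [c c0 [rcv cv]] := isroot_normalize rv.
have vv : dot (a *: d + b *: d' + w) (a *: d + b *: d' + w) = a ^+ 2 + b ^+ 2 + om.
  by rewrite !dotE dd d'd' dd' (dotC d' d) dd' dw d'w (dotC w d) dw (dotC w d') d'w /om; ring.
rewrite vv in cv.
have vw : dot (c *: (a *: d + b *: d' + w)) w = c * om.
  by rewrite !dotE dw d'w /om; ring.
have Pcv : P (c *: (a *: d + b *: d' + w)).
  split=> //; first by rewrite vw mulf_neq0 ?gt_eqF.
  by exists (c * a), (c * b), c; rewrite !scalerDr !scalerA.
have [u [[ru uw0 [x [y [z uE]]]] hmin]] :
    exists u, P u /\ forall u', P u' -> dot u w ^+ 2 <= dot u' w ^+ 2.
  apply: (lowest_root hN2 isolated (P := P)) => //; first by move=> u [].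
  by exists (c *: (a *: d + b *: d' + w)).
have uw : dot u w = z * om by rewrite uE !dotE dw d'w /om; ring.
have z0 : z != 0 by apply: contra uw0 => /eqP; rewrite uw => ->; rewrite mul0r.
have u1 : x ^+ 2 + y ^+ 2 + z ^+ 2 * om = 1.
  have := ru.2; rewrite uE !dotE dd d'd' dd' (dotC d' d) dd' dw d'w (dotC w d) dw (dotC w d') d'w -/om.
  by move=> <-; ring.
have zo : z ^+ 2 * om = 1 - x ^+ 2 - y ^+ 2 by rewrite -u1; ring.
have angle p q : isroot N (p *: d + q *: d') ->
    let t := (x * p + y * q) ^+ 2 / (p ^+ 2 + q ^+ 2) in t = 0 \/ 4 * t = 1 \/ 1 <= 2 * t.
  move=> re.
  have ue : dot u (p *: d + q *: d') = x * p + y * q.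
    by rewrite uE !dotE dd d'd' dd' (dotC d' d) dd' (dotC w d) dw (dotC w d') d'w; ring.
  have ee : dot (p *: d + q *: d') (p *: d + q *: d') = p ^+ 2 + q ^+ 2.
    by rewrite !dotE dd d'd' dd' (dotC d' d) dd'; ring.
  rewrite -ue -ee; apply: (lowest_root_angle hmin ru uw0 re).
    by rewrite !dotE dw d'w; ring.
  move=> s t rst s0; split=> //.
    rewrite !dotE uw dw d'w [X in X != 0](_ : _ = s * (z * om)); last by ring.
    by rewrite mulf_neq0 // -uw.
  exists (s * x + t * p), (s * y + t * q), (s * z); rewrite uE.
  by apply/matrixP => k l; rewrite !mxE; ring.
have xy1 : 0 < x ^+ 2 + y ^+ 2 < 1.
  have z2 : 0 < z ^+ 2 by rewrite exprn_even_gt0.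
  have a2 : 0 < a ^+ 2 by rewrite exprn_even_gt0.
  have b2 := sqr_ge0 b.
  have c2 : 0 < c ^+ 2 by rewrite exprn_gt0.
  have := hmin _ Pcv; rewrite uw vw !exprMn ler_pM2r ?exprn_gt0 // => zc.
  have co : c ^+ 2 * om < 1 by nra.
  have zc2 : z ^+ 2 * om <= c ^+ 2 * om by rewrite ler_pM2r.
  have zo0 : 0 < z ^+ 2 * om by rewrite mulr_gt0.
  by apply/andP; split; lra.
have ax : x ^+ 2 = 0 \/ 4 * x ^+ 2 = 1 \/ 1 <= 2 * x ^+ 2.
  have := angle 1 0; rewrite scale1r scale0r addr0 !mulr1 !mulr0 expr1n expr0n /= !addr0 divr1.
  exact.
have ay : y ^+ 2 = 0 \/ 4 * y ^+ 2 = 1 \/ 1 <= 2 * y ^+ 2.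
  have := angle 0 1; rewrite scale1r scale0r add0r !mulr1 !mulr0 expr1n expr0n /= !add0r divr1.
  exact.
have ap : (x + y) ^+ 2 / 2 = 0 \/ 4 * ((x + y) ^+ 2 / 2) = 1 \/ 1 <= 2 * ((x + y) ^+ 2 / 2).
  by have := angle 1 1; rewrite !scale1r !mulr1 expr1n; apply.
have am : (x - y) ^+ 2 / 2 = 0 \/ 4 * ((x - y) ^+ 2 / 2) = 1 \/ 1 <= 2 * ((x - y) ^+ 2 / 2).
  by have := angle 1 (-1); rewrite scale1r scaleN1r mulr1 mulrN1 expr1n sqrrN expr1n; apply.
have cases := two_cosines ax ay ap am xy1.
have [y1 [z1 [y1a ry1 y1z1]]] : exists (y : 'cV[R]_m) z,
    [/\ axis_or_diagonal i i' y, isroot N (at_col j y + z *: w) & dot y y = z ^+ 2 * om].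
  case: cases => [[y0 x2]|[x0 y2]|[s [ys x2]]].
  - have x0 := neq0_of_mulsqr x2.
    exists (delta_mx i 0), (z / x); split; first by constructor 1.
      have := isrootZ (invr_neq0 x0) ru.1; rewrite uE y0 scale0r addr0 scalerDr !scalerA.
      by rewrite mulVf // scale1r dAt mulrC.
    rewrite dE; last by constructor 1.
    rewrite dAt dd expr_div_n -mulrAC [z ^+ 2 * om](_ : _ = x ^+ 2); first by rewrite divff // sqrf_eq0.
    by rewrite zo y0 expr0n subr0 -x2; ring.
  - have y0 := neq0_of_mulsqr y2.
    exists (delta_mx i' 0), (z / y); split; first by constructor 2.
      have := isrootZ (invr_neq0 y0) ru.1; rewrite uE x0 scale0r add0r scalerDr !scalerA.
      by rewrite mulVf // scale1r dAt' mulrC.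
    rewrite dE; last by constructor 2.
    rewrite dAt' d'd' expr_div_n -mulrAC [z ^+ 2 * om](_ : _ = y ^+ 2); first by rewrite divff // sqrf_eq0.
    by rewrite zo x0 expr0n subr0 -y2; ring.
  - have x0 := neq0_of_mulsqr x2.
    have ya : axis_or_diagonal i i' (delta_mx i 0 + (-1) ^+ s *: delta_mx i' 0) by constructor 3; exists s.
    exists (delta_mx i 0 + (-1) ^+ s *: delta_mx i' 0), (z / x); split=> //.
      have := isrootZ (invr_neq0 x0) ru.1; rewrite uE ys !scalerDr !scalerA.
      rewrite mulVf // scale1r linearD linearZ /= dAt dAt' (mulrC x^-1 z) mulrCA mulVf // mulr1.
      exact.
    rewrite dE // linearD linearZ /= dAt dAt' !dotE dd d'd' dd' (dotC d' d) dd' !mulr0 !addr0 add0r mulr1.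
    rewrite -expr2 sqrr_sign expr_div_n -mulrAC [z ^+ 2 * om](_ : _ = 2 * x ^+ 2).
      by rewrite mulfK // sqrf_eq0.
    by rewrite zo ys exprMn sqrr_sign mul1r -[X in X - _ - _]x2; ring.
have ry1' : isroot N (at_col j y1) by exact: isroot_axis_or_diagonal y1a.
split; first by exists y1, z1; split.
- have y1w : dot (at_col j y1) w = 0.
    have : exists p q, at_col j y1 = p *: d + q *: d'.
      case: y1a => [->|->|[s ->]]; rewrite ?linearD ?linearZ /= ?dAt ?dAt'.
      + by exists 1, 0; rewrite scale1r scale0r addr0.
      + by exists 0, 1; rewrite scale1r scale0r add0r.
      + by exists 1, ((-1) ^+ s); rewrite scale1r.
    by case=> p [q ->]; rewrite !dotE dw d'w; ring.
  have yy : dot (at_col j y1) (at_col j y1) = z1 ^+ 2 * om by rewrite -dE.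
  have yy0 : z1 ^+ 2 * om != 0 by rewrite -yy dot_eq0; case: ry1'.
  have z10 : z1 != 0 by apply: contra yy0 => /eqP ->; rewrite expr0n mul0r.
  have := isroot_refl ry1 ry1'.
  have -> : refl (at_col j y1 + z1 *: w) (at_col j y1) = - z1 *: w.
    rewrite /refl !(dotDl, dotDr, dotZl, dotZr) (dotC w) y1w yy -/om !mulr0 addr0 add0r.
    have -> : z1 ^+ 2 * om + z1 * (z1 * om) = 2 * (z1 ^+ 2 * om) by ring.
    rewrite divff; last by rewrite mulf_neq0 // pnatr_eq0.
    by rewrite scale1r opprD addrA subrr add0r scaleNr.
  by move/(isrootZ (invr_neq0 (_ : - z1 != 0))); rewrite oppr_eq0 scalerA mulVf ?oppr_eq0 // scale1r; apply.
- move=> p q rpq; have := angle p q rpq.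
  have pq0 : 0 < p ^+ 2 + q ^+ 2.
    have := rpq.1; rewrite -dot_gt0 !dotE dd d'd' dd' (dotC d' d) dd'.
    by rewrite !mulr0 addr0 add0r !mulr1 -!expr2.
  exact: four_lines.
Qed.
End Reduction.

(** * Reduction to two columns *)

Section TwoColumns.
Variables (R : realType) (m n : nat) (N1 : 'cV[R]_n -> R) (N2 : 'cV[R]_m -> R).
Hypotheses (hm : (1 < m)%N).
Hypotheses (hN1 : symmetric_norm N1) (hN1n : normalized N1).
Hypotheses (hN2 : symmetric_norm N2) (hN2n : normalized N2).
Local Notation N := (mixed_norm N1 N2).
Local Notation V := 'M[R]_(m, n).
Local Notation K := ('I_m * 'I_n)%type.
Local Notation unit_root := (@unit_root R m n N1 N2).
Implicit Types (u v w x : V).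

Hypothesis isolated : exists eps, 0 < eps /\
  forall i j u, unit_root u -> dot (u - delta_mx i j) (u - delta_mx i j) < eps ->
    u = delta_mx i j.

Lemma other_row (i : 'I_m) : exists i', i != i'.
Proof.
have [->|h] := eqVneq i (Defs.coord0 hm); first by exists (coord1 hm).
by exists (Defs.coord0 hm).
Qed.

Definition supp v : {set K} := [set k | v k.1 k.2 != 0].

Definition clear_pair i i' j v : V :=
  \matrix_(r, s) (if (s == j) && ((r == i) || (r == i')) then 0 else v r s).

Lemma clear_pair_split i i' j v : i != i' ->
  v = v i j *: delta_mx i j + v i' j *: delta_mx i' j + clear_pair i i' j v.
Proof.
move=> ii; apply/matrixP => r s; rewrite !mxE.
have [->|sj] := eqVneq s j; last by rewrite !andbF !mulr0 !add0r.
have [->|ri] := eqVneq r i; first by rewrite (negbTE ii) /= !mulr1 mulr0 !addr0.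
have [->|ri'] := eqVneq r i'; first by rewrite /= mulr1 mulr0 add0r addr0.
by rewrite /= !mulr0 !add0r.
Qed.

Lemma supp_clear_pair i i' j v : v i j != 0 -> (#|supp (clear_pair i i' j v)| < #|supp v|)%N.
Proof.
move=> vij; apply: proper_card; apply/properP; split.
  apply/fintype.subsetP => k; rewrite !inE mxE.
  by case: ifP; rewrite ?eqxx.
exists (i, j); first by rewrite inE.
by rewrite inE mxE /= !eqxx.
Qed.

Lemma isroot_clear_pair i i' j v : i != i' -> isroot N v -> v i j != 0 -> clear_pair i i' j v != 0 ->
  [/\ exists (y : 'cV[R]_m) z, [/\ axis_or_diagonal i i' y, isroot N (at_col j y + z *: clear_pair i i' j v) &
                      dot y y = z ^+ 2 * dot (clear_pair i i' j v) (clear_pair i i' j v)],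
      isroot N (clear_pair i i' j v) &
      forall p q, isroot N (p *: delta_mx i j + q *: delta_mx i' j) ->
        [\/ p = 0, q = 0 | exists b : bool, q = (-1) ^+ b * p]].
Proof.
move=> ii rv vij k0; have k1 : clear_pair i i' j v i j = 0 by rewrite mxE !eqxx.
have k2 : clear_pair i i' j v i' j = 0 by rewrite mxE !eqxx orbT.
rewrite {1}(clear_pair_split j v ii) in rv.
exact: (isroot_prism hN2 isolated ii k1 k2 k0 rv vij).
Qed.

(** Take a crossing root of minimal support.  By [isroot_clear_pair], deleting two entries
    of one column leaves a root, which must lie in a single column.  So the root
    lies in two columns, with at most two entries in each.  The part in column [j]
    becomes [y] by [isroot_prism], and the part in column [j'], being a root of its
    coordinate plane, lies on an axis or a diagonal.  In the diagonal case no third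
    row exists: with it in place of [k'], the deletion would leave a crossing
    root. *)
Lemma two_column_root v0 : isroot N v0 -> cross v0 ->
  exists i i' k k' j j' (y z : 'cV[R]_m),
    [/\ [/\ i != i', k != k' & j != j'],
        isroot N (at_col j y - at_col j' z), dot y y = dot z z, axis_or_diagonal i i' y &
        exists c, z = c *: delta_mx k 0 \/
          ((forall r, r = k \/ r = k') /\
           exists b : bool, z = c *: (delta_mx k 0 + (-1) ^+ b *: delta_mx k' 0))].
Proof.
move=> rv0 cv0.
have [v [rv cv] hmin] : exists2 v, isroot N v /\ cross v &
    forall u, isroot N u -> (#|supp u| < #|supp v|)%N -> ~ cross u.
  have [q] := ubnP #|supp v0|; elim: q v0 rv0 cv0 => // q IH v rv cv vq.
  have [[u [ru uv cu]]|no] := pselect (exists u, [/\ isroot N u, (#|supp u| < #|supp v|)%N & cross u]).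
    by apply: (IH u) => //; apply: leq_trans uv _.
  by exists v => // u ru uv cu; apply: no; exists u.
have [i [j [k [j' [jj vij vkj]]]]] := cv.
have [i' ii] := other_row i; have [k' kk] := other_row k.
(* Deleting entries of column s leaves a root, which lies in the column t of p. *)
have away r r' s t p : r != r' -> v r s != 0 -> s != t -> v p t != 0 ->
    forall a b, clear_pair r r' s v a b != 0 -> b = t.
  move=> rr vrs st vpt a b kab; apply/eqP; apply: contrapT => /negP bt.
  have ts : (t == s) = false by rewrite eq_sym (negbTE st).
  have kpt : clear_pair r r' s v p t != 0 by rewrite mxE ts.
  have k0 : clear_pair r r' s v != 0 by apply: contra kpt => /eqP ->; rewrite mxE.
  have [_ rk _] := isroot_clear_pair rr rv vrs k0.
  apply: (hmin _ rk (supp_clear_pair r' vrs)).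
  by exists a, b, p, t.
have vj s t : v s t != 0 -> t = j' \/ (t = j /\ (s = i \/ s = i')).
  move=> vst; have [|k1] := eqVneq (clear_pair i i' j v s t) 0; last first.
    by left; exact: (away i i' j j' k ii vij jj vkj _ _ k1).
  rewrite mxE; case: ifP => [/andP[/eqP tj h] _|_ e]; last by rewrite e eqxx in vst.
  by right; split=> //; case/orP: h => /eqP; [left|right].
have jj2 : j' != j by rewrite eq_sym.
have vj' k2 s t : k != k2 -> v s t != 0 -> t = j \/ (t = j' /\ (s = k \/ s = k2)).
  move=> kk2 vst; have [|k1] := eqVneq (clear_pair k k2 j' v s t) 0; last first.
    by left; exact: (away k k2 j' j i kk2 vkj jj2 vij _ _ k1).
  rewrite mxE; case: ifP => [/andP[/eqP tj h] _|_ e]; last by rewrite e eqxx in vst.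
  by right; split=> //; case/orP: h => /eqP; [left|right].
have k0 : clear_pair i i' j v != 0.
  by apply/eqP => /matrixP/(_ k j'); rewrite !mxE (negbTE jj2) /=; apply/eqP.
have [[y [z [ya ry yz]]] rw _] := isroot_clear_pair ii rv vij k0.
have wE : clear_pair i i' j v = v k j' *: delta_mx k j' + v k' j' *: delta_mx k' j'.
  have kk' : (k' == k) = false by rewrite eq_sym (negbTE kk).
  apply/matrixP => s t; rewrite !mxE.
  have [->|tj] := eqVneq t j'.
    rewrite (negbTE jj2) /= !andbT; have [->|sk] := eqVneq s k.
      by rewrite (negbTE kk) mulr1 mulr0 addr0.
    have [->|sk'] := eqVneq s k'; first by rewrite mulr1 mulr0 add0r.
    rewrite !mulr0 addr0; apply/eqP/negPn/negP => /(vj' k' s j' kk) [h|[_ [h|h]]].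
    - by rewrite h eqxx in jj2.
    - by rewrite h eqxx in sk.
    - by rewrite h eqxx in sk'.
  rewrite !andbF !mulr0 addr0; case: ifPn => // h; apply/eqP/negPn/negP.
  move=> /(vj s t) [e|[e1 e2]]; first by rewrite e eqxx in tj.
  by case: e2 h => ->; rewrite e1 !eqxx ?orbT.
have k0' : clear_pair k k' j' v != 0.
  by apply/eqP => /matrixP/(_ i j); rewrite !mxE (negbTE jj) /=; apply/eqP.
have [_ _ hangle] := isroot_clear_pair kk rv vkj k0'.
rewrite wE in rw; have {}hangle := hangle _ _ rw.
have finish (zc : 'cV[R]_m) : - z *: clear_pair i i' j v = at_col j' zc ->
    isroot N (at_col j y - at_col j' zc) /\ dot y y = dot zc zc.
  move=> e; rewrite -e scaleNr opprK; split=> //.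
  transitivity (dot (at_col j' zc) (at_col j' zc)); last by rewrite dot_at_col col_at_col eqxx.
  by rewrite -e dotZl dotZr yz; ring.
have [vk'|vk'] := eqVneq (v k' j') 0.
  exists i, i', k, k', j, j', y, ((- z * v k j') *: delta_mx k 0).
  have e : - z *: clear_pair i i' j v = at_col j' ((- z * v k j') *: delta_mx k 0).
    by rewrite wE vk' scale0r addr0 [RHS]linearZ /= at_col_delta scalerA.
  have [r1 r2] := finish _ e.
  split=> //; exists (- z * v k j'); by left.
have [b vb] : exists b : bool, v k' j' = (-1) ^+ b * v k j'.
  case: hangle => [h|h|//]; first by rewrite h eqxx in vkj.
  by rewrite h eqxx in vk'.
pose zc : 'cV[R]_m := (- z * v k j') *: (delta_mx k 0 + (-1) ^+ b *: delta_mx k' 0).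
have ezc : - z *: clear_pair i i' j v = at_col j' zc.
  apply/matrixP => s t; rewrite wE vb !mxE !andbT.
  by case: (t == j'); rewrite ?andbT ?andbF /=; ring.
have [r1 r2] := finish zc ezc.
exists i, i', k, k', j, j', y, zc; split=> //; exists (- z * v k j'); right; split; last by exists b.
move=> r; have [->|rk] := eqVneq r k; first by left.
have kr : k != r by rewrite eq_sym.
case: (vj' r k' j' kr vk') => [h|[_ [h|->]]]; last by right.
  by rewrite h eqxx in jj2.
by rewrite h eqxx in kk.
Qed.
End TwoColumns.

(** * Isometries when no root crosses columns *)

Section ColumnForm.
Variables (R : realType) (m n : nat) (N1 : 'cV[R]_n -> R) (N2 : 'cV[R]_m -> R).
Hypotheses (hm : (1 < m)%N).
Hypotheses (hN1 : symmetric_norm N1) (hN1n : normalized N1).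
Hypotheses (hN2 : symmetric_norm N2) (hN2n : normalized N2).
Local Notation N := (mixed_norm N1 N2).
Local Notation V := 'M[R]_(m, n).
Let r0 : 'I_m := Defs.coord0 hm.

Lemma mixed_at_col j (y : 'cV[R]_m) : N (at_col j y) = N2 y.
Proof.
rewrite -[RHS](ger0_norm (is_norm_ge0 (symmetric_is_norm hN2) y)).
rewrite -(normalizedZ hN1 hN1n j); congr N1; apply/colP => k.
rewrite !mxE col_at_col andbT; case: (k == j); first by rewrite mulr1.
by rewrite mulr0 (is_norm0 (symmetric_is_norm hN2)).
Qed.

Lemma sum_at_col (A : V) : A = \sum_j at_col j (col j A).
Proof.
apply/matrixP => i k; rewrite summxE (bigD1 k) //= !mxE eqxx mulr1n big1 ?addr0 //.
by move=> j /negbTE jk; rewrite !mxE eq_sym jk mulr0n.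
Qed.

(** The isometry permutes the roots, each of which lies in one column.  Since the
    sum of two coordinate vectors of column [j] is also a root, their images lie in
    the same column [sigma j]; and [sigma] is onto because [Psi] is. *)
Lemma column_form (Psi : {linear V -> V}) : (forall x, N (Psi x) = N x) ->
  (forall u, isroot N u -> ~ cross u) ->
  exists (S : 'I_n -> {linear 'cV[R]_m -> 'cV[R]_m}) (pi : 'S_n),
    (forall j, isometry_for N2 (S j)) /\
    forall (A : V) (j : 'I_n), col j (Psi A) = S j (col (pi j) A).
Proof.
move=> hPsi nocross.
have od := isometry_dot hN1 hN1n hN2 hN2n hPsi.
have [Phi [hPhi PsiK PhiK]] := isometry_inverse hN1 hN2 hPsi.
have rPsi u : isroot N u -> isroot N (Psi u) by apply: isroot_map PsiK.
have single u p s q t : isroot N u -> u p s != 0 -> u q t != 0 -> s = t.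
  move=> ru ps qt; apply/eqP; apply: contrapT => /negP st.
  by apply: (nocross u ru); exists p, s, q, t.
have [sigma hsigma] : exists sigma : 'I_n -> 'I_n, forall j i p t,
    Psi (delta_mx i j) p t != 0 -> t = sigma j.
  apply: (@fin_all_exists _ _ (fun j s => forall i p t, Psi (delta_mx i j) p t != 0 -> t = s)) => j.
  have rj : isroot N (Psi (delta_mx r0 j)) by apply: rPsi; exact: isroot_delta.
  have [p0 [s0 h0]] : exists p s, Psi (delta_mx r0 j) p s != 0.
    apply: contrapT => hno; case: rj => /eqP rj _; apply: rj.
    apply/matrixP => p s; rewrite [RHS]mxE; apply: contrapT => /eqP hps.
    by apply: hno; exists p, s.
  exists s0 => i p t hpt; have ri : isroot N (Psi (delta_mx i j)).
    by apply: rPsi; exact: isroot_delta.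
  have [ir|ir] := eqVneq i r0; first by rewrite ir in hpt; exact: (single _ _ _ _ _ rj hpt h0).
  apply/eqP; apply: contrapT => /negP ts.
  have rs : isroot N (Psi (delta_mx r0 j) + Psi (delta_mx i j)).
    by rewrite -linearD; apply: rPsi; apply: isroot_deltaD; rewrite // eq_sym.
  have z1 : Psi (delta_mx r0 j) p t = 0.
    apply/eqP/negPn/negP => h; have := single _ _ _ _ _ rj h h0.
    by move/eqP; rewrite (negbTE ts).
  have z2 : Psi (delta_mx i j) p0 s0 = 0.
    apply/eqP/negPn/negP => h; have := single _ _ _ _ _ ri hpt h.
    by move/eqP; rewrite (negbTE ts).
  have := single _ p t p0 s0 rs; rewrite !mxE z1 z2 add0r addr0 => /(_ hpt h0)/eqP.
  by rewrite (negbTE ts).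
have zero i j p t : t != sigma j -> Psi (delta_mx i j) p t = 0.
  by move=> ts; apply/eqP/negPn/negP => /hsigma/eqP; rewrite (negbTE ts).
have [tau htau] : exists tau : 'I_n -> 'I_n, forall t, sigma (tau t) = t.
  apply: (@fin_all_exists _ _ (fun t j => sigma j = t)) => t.
  apply: contrapT => hno; have := congr1 (fun A : V => A r0 t) (PsiK (delta_mx r0 t)).
  rewrite /= mxE !eqxx linear_sum_delta summxE big1 => [|k _].
    by move/eqP; rewrite eq_sym oner_eq0.
  rewrite mxE zero ?mulr0 //; apply/eqP => e; apply: hno.
  by exists k.2.
pose pi : 'S_n := perm (can_inj htau).
have piE t : pi t = tau t by rewrite permE.
have sigmaK j : pi (sigma j) = j.
  have -> : j = pi (pi^-1%g j) by rewrite permKV.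
  by rewrite [pi (pi^-1%g j)]piE htau piE.
have colPsi j t (y : 'cV[R]_m) : t != sigma j -> col t (Psi (at_col j y)) = 0.
  move=> ts; apply/colP => p; rewrite !mxE linear_sum_delta summxE big1 // => k _.
  rewrite mxE; have [kj|kj] := eqVneq k.2 j; first by rewrite kj zero // mulr0.
  by rewrite mxE (negbTE kj) mulr0n mul0r.
have linS t : linear (fun y : 'cV[R]_m => col t (Psi (at_col (pi t) y))).
  by move=> a x y; rewrite !linearP; apply/colP => p; rewrite !mxE.
pose S t : {linear 'cV[R]_m -> 'cV[R]_m} :=
  HB.pack (fun y : 'cV[R]_m => col t (Psi (at_col (pi t) y)))
    (GRing.isLinear.Build R 'cV[R]_m 'cV[R]_m *:%R _ (linS t)).
exists S, pi; split=> [t y|A t].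
  rewrite -(mixed_at_col t) -(mixed_at_col (pi t) y) -[RHS]hPsi; congr N.
  rewrite [RHS]sum_at_col (bigD1 t) //= big1 ?addr0 // => s st.
  by rewrite colPsi ?linear0 // piE htau.
rewrite {1}[A]sum_at_col linear_sum linear_sum (bigD1 (pi t)) //= big1 ?addr0 // => j jt.
by rewrite colPsi //; apply: contra jt => /eqP ->; rewrite sigmaK.
Qed.
End ColumnForm.

(** * The exceptional pair of norms *)

Section Atoms.
Variables (R : realType).

(** All [s i] are at most 1, so [s i `^ r - s i ^+ 2] has the same sign for every
    [i]; as these differences add up to 0, each of them vanishes, and a nonzero
    [s i] equals 1. *)
Lemma unit_power_sum (I : finType) (s : I -> R) (r : R) : r != 2 -> 0 < r ->
  (forall i, 0 <= s i) -> \sum_i s i ^+ 2 = 1 -> \sum_i s i `^ r = 1 ->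
  exists i, s i = 1.
Proof.
move=> r2 r0 s0 hs hr.
have s1 i : s i <= 1.
  have : s i ^+ 2 <= 1.
    rewrite -hs (bigD1 i) //= lerDl; apply: sumr_ge0 => k _; exact: sqr_ge0.
  have := s0 i; nra.
have heq i : s i `^ r = s i ^+ 2.
  have [r2'|r2'] := ltP r 2.
    have ge0 k : true -> 0 <= s k `^ r - s k ^+ 2.
      move=> _; have [->|sk] := eqVneq (s k) 0; first by rewrite expr0n subr0 powR_ge0.
      have sk0 : 0 < s k by rewrite lt_neqAle eq_sym sk s0.
      rewrite subr_ge0 -powR_mulrn //; apply: ger_powR; first by rewrite sk0 s1.
      exact: ltW.
    have h : \sum_i (s i `^ r - s i ^+ 2) = 0 by rewrite sumrB hs hr subrr.
    have h' := psumr_eq0P ge0 h.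
    by apply/eqP; rewrite -subr_eq0 h'.
  have ge0 k : true -> 0 <= s k ^+ 2 - s k `^ r.
    move=> _; have [->|sk] := eqVneq (s k) 0; first by rewrite powR0 ?gt_eqF // expr0n subr0.
    have sk0 : 0 < s k by rewrite lt_neqAle eq_sym sk s0.
    rewrite subr_ge0 -powR_mulrn //; apply: ger_powR; first by rewrite sk0 s1.
    exact: r2'.
  have h : \sum_i (s i ^+ 2 - s i `^ r) = 0 by rewrite sumrB hs hr subrr.
  have h' := psumr_eq0P ge0 h.
  by apply/esym/eqP; rewrite -subr_eq0 h'.
have [i si] : exists i, s i != 0.
  apply: contrapT => hno; move: hs; rewrite big1 => [/eqP|i _].
    by rewrite eq_sym oner_eq0.
  have [->|si] := eqVneq (s i) 0; first by rewrite expr0n.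
  by case: hno; exists i.
exists i; have si0 : 0 < s i by rewrite lt_neqAle eq_sym si s0.
have := congr1 (@ln R) (heq i); rewrite ln_powR lnXn // => h.
have /eqP : (r - 2) * ln (s i) = 0 by rewrite mulrBl h mulr_natl subrr.
by rewrite mulf_eq0 subr_eq0 (negbTE r2) /= ln_eq0 // => /eqP.
Qed.

Lemma bigmax_attained (I : finType) (s : I -> R) c : 0 < c ->
  \big[Num.max/0]_i s i = c -> exists i, s i = c.
Proof.
move=> c0 h; apply: contrapT => hno.
have [i0|] := pselect (exists i : I, True); last first.
  move=> hI; have : \big[Num.max/0]_i s i <= 0.
    by apply: bigmax_le => // i _; case: hI; exists i.
  by rewrite h leNgt c0.
have : \big[Num.max/0]_i s i < c.
  apply: bigmax_lt => // i _; rewrite lt_neqAle; apply/andP; split.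
    by apply/eqP => e; apply: hno; exists i.
  by rewrite -h le_bigmax.
by rewrite h ltxx.
Qed.

End Atoms.

Section TwoRows.
Variables (R : realType) (m n : nat) (hm : (1 < m)%N) (m2 : m = 2%N).
Local Notation r0 := (Defs.coord0 hm).
Local Notation r1 := (Defs.coord1 hm).

Lemma row_cases (i : 'I_m) : i = r0 \/ i = r1.
Proof.
have := ltn_ord i; rewrite {2}m2; case e : (val i) => [|[|q]] // _.
  by left; apply: val_inj.
by right; apply: val_inj.
Qed.

Lemma sum_two_rows (f : 'I_m -> R) : \sum_i f i = f r0 + f r1.
Proof.
rewrite (bigD1 r0) //= (bigD1 r1) //= big1 ?addr0 // => i /andP[i0 i1].
by case: (row_cases i) => e; rewrite e eqxx in i0 i1.
Qed.

Lemma lp_pairC p (s t : R) : lp_pair p s t = lp_pair p t s.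
Proof. case: p => [r| |]; rewrite /lp_pair; [by rewrite addrC | exact: maxC | reflexivity]. Qed.

Lemma lp_pair_half p (s t : R) : (1%:E <= p)%E -> 0 <= s -> 0 <= t ->
  lp_pair p (s / 2) (t / 2) = lp_pair p s t / 2.
Proof.
case: p => [r| |]; last by rewrite leeNy_eq.
  rewrite lee_fin => r1 s0 t0; rewrite /lp_pair; have r0 : 0 < r by apply: lt_le_trans r1.
  have h0 : 0 <= 2^-1 :> R by rewrite invr_ge0 ler0n.
  have rn0 : r != 0 by rewrite gt_eqF.
  rewrite (powRM _ s0 h0) (powRM _ t0 h0) -mulrDl.
  rewrite (powRM _ (addr_ge0 (powR_ge0 _ _) (powR_ge0 _ _)) (powR_ge0 _ _)).
  by rewrite (powRKV rn0 h0).
by move=> _ s0 t0; rewrite /lp_pair maxr_pMl // invr_ge0 ler0n.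
Qed.

(** The value at a coordinate vector determines the factor [a]. *)
Lemma is_Ep2_lp_pair (N2 : 'cV[R]_m -> R) p a : (1%:E <= p)%E -> normalized N2 ->
  (forall y, N2 y = a * lp_pair p (`|y r0 0 + y r1 0| / 2) (`|y r0 0 - y r1 0| / 2)) ->
  is_Ep2 hm p N2.
Proof.
move=> p1 hn hN; split=> // y.
have := hN (delta_mx r0 0); rewrite hn !mxE !eqxx /= subr0 addr0 normr1 => h1.
rewrite hN !lp_pair_half ?normr_ge0 // in h1 *.
move: (normr_ge0 (y r0 0 + y r1 0)) (normr_ge0 (y r0 0 - y r1 0)) => s0 t0.
rewrite /Ep_norm; set s := `|_ + _| in s0 *; set t := `|_ - _| in t0 *.
case: p p1 {hN} h1 => [r| |]; [|rewrite /lp_pair maxxx => _ h1|by rewrite leeNy_eq].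
  rewrite lee_fin => p1; rewrite /lp_pair => h1.
  have rpos : 0 < r by apply: lt_le_trans p1.
  have h0 : 0 <= 2^-1 :> R by rewrite invr_ge0 ler0n.
  have h2 : 0 <= 2 :> R by rewrite ler0n.
  have two : (2 : R) `^ r^-1 * 2^-1 `^ r^-1 = 1.
    by rewrite -(powRM _ h2 h0) divff ?pnatr_eq0 // powR1.
  rewrite powR1 -[1 + 1]/(2 : R) in h1.
  rewrite -mulrDl (powRM _ (addr_ge0 (powR_ge0 _ _) (powR_ge0 _ _)) h0).
  have b0 : 0 < (2 : R) `^ r^-1 by rewrite powR_gt0 ?ltr0n.
  move: ((2 : R) `^ r^-1) (2^-1 `^ r^-1) ((s `^ r + t `^ r) `^ r^-1) h1 two b0.
  move=> b c X h1 two b0.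
  have -> : c = a / 2 by apply: (mulfI (lt0r_neq0 b0)); rewrite two {1}h1; ring.
  ring.
have -> : a = 2 by lra.
by field.
Qed.

End TwoRows.

Section Main.
Variables (R : realType) (m n : nat) (N1 : 'cV[R]_n -> R) (N2 : 'cV[R]_m -> R).
Hypotheses (hm : (1 < m)%N).
Hypotheses (hN1 : symmetric_norm N1) (hN1n : normalized N1).
Hypotheses (hN2 : symmetric_norm N2) (hN2n : normalized N2).
Hypothesis hlp : ~ exists p : \bar R,
  [/\ (1%:E <= p)%E, N1 =1 lp_norm p & N2 =1 lp_norm p].
Local Notation N := (mixed_norm N1 N2).
Local Notation V := 'M[R]_(m, n).
Local Notation r0 := (Defs.coord0 hm).
Local Notation r1 := (Defs.coord1 hm).

(** Inside its coordinate plane, [y] has an orthogonal vector of the same norm. *)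
Lemma orthogonal_partner i i' (y : 'cV[R]_m) c : i != i' -> axis_or_diagonal i i' y ->
  exists y', dot (c *: y) (c *: y') = 0 /\ N2 (c *: y') = N2 (c *: y).
Proof.
move=> ii ya; suff [y' [d0 Ny]] : exists y', dot y y' = 0 /\ N2 y' = N2 y.
  exists y'; rewrite dotZl dotZr d0 !mulr0; split=> //.
  by rewrite !(norm_homogeneous (symmetric_is_norm hN2)) Ny.
have i'i : (i' == i) = false by rewrite eq_sym (negbTE ii).
case: ya => [->|->|[b ->]].
- by exists (delta_mx i' 0); rewrite dot_deltas i'i !hN2n.
- by exists (delta_mx i 0); rewrite dot_deltas (negbTE ii) !hN2n.
exists (delta_mx i 0 - (-1) ^+ b *: delta_mx i' 0); split.
  rewrite !dotE !dot_deltas !eqxx i'i (negbTE ii) /= !mulr0 !mulr1.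
  by rewrite -expr2 sqrr_sign; ring.
apply: symmetric_norm_abs => // k; rewrite !mxE !andbT.
have [->|ki] := eqVneq k i; first by rewrite (negbTE ii) !mulr0 subr0 addr0.
by rewrite sub0r add0r normrN.
Qed.

(** By [swap_delta_lp] such a root would make both norms the same lp-norm. *)
Lemma no_swap_delta i j j' (z z' : 'cV[R]_m) : j != j' -> dot z z = 1 ->
  isroot N (at_col j (delta_mx i 0) - at_col j' z) ->
  dot z z' = 0 -> N2 z' = N2 z -> False.
Proof.
move=> jj z1 ru zz' Nz'; apply: hlp.
have [i' ii] := other_row hm i.
have d1 : dot (delta_mx i 0 : 'cV[R]_m) (delta_mx i 0) = dot z z.
  by rewrite dot_deltas !eqxx z1.
have d0 : (delta_mx i 0 : 'cV[R]_m) != 0 by exact: delta_neq0.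
have dd : dot (delta_mx i 0 : 'cV[R]_m) (delta_mx i' 0) = 0.
  by rewrite dot_deltas eq_sym (negbTE ii).
have Nd : N2 (delta_mx i' 0) = N2 (delta_mx i 0) by rewrite !hN2n.
exact: (swap_delta_lp hN1 hN1n hN2 hN2n i jj d1 ru d0 dd zz' Nd Nz' (erefl _)).
Qed.

Lemma no_exchange i j i' j' : j != j' -> ~ isroot N (delta_mx i j - delta_mx i' j').
Proof.
move=> jj; rewrite -(at_col_delta R j i) -(at_col_delta R j' i') => ru.
have [i2 ii2] := other_row hm i'.
apply: (no_swap_delta jj _ ru (z' := delta_mx i2 0)); last by rewrite !hN2n.
  by rewrite dot_deltas !eqxx.
by rewrite dot_deltas eq_sym (negbTE ii2).
Qed.

(** The root of [two_column_root] exchanges multiples of [y] and [z].  Neither can be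
    a coordinate vector, by [no_swap_delta].  So both are diagonals, of equal length,
    and there are only two rows; [swap_lp] then computes [N1], and [N2] in the basis
    of the diagonals [z] and [z2]. *)
Lemma cross_root_exceptional v : isroot N v -> cross v ->
  exists p : \bar R, [/\ (1%:E <= p)%E, N1 =1 lp_norm p & is_Ep2 hm p N2].
Proof.
move=> rv cv; have iso := delta_isolated hN1 hN1n hN2 hN2n no_exchange rv cv.
have [i [i' [k [k' [j [j' [y [z [[ii kk jj] ru yz ya [c zc]]]]]]]]]] :=
  two_column_root hm hN2 iso rv cv.
have i'i : (i' == i) = false by rewrite eq_sym (negbTE ii).
have [z' [zz' Nz']] : exists z', dot z z' = 0 /\ N2 z' = N2 z.
  case: zc => [->|[_ [b ->]]].
    have ka : axis_or_diagonal k k' (delta_mx k 0 : 'cV[R]_m) by constructor 1.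
    by have [z' h] := orthogonal_partner c kk ka; exists (c *: z').
  have ka : axis_or_diagonal k k' (delta_mx k 0 + (-1) ^+ b *: delta_mx k' 0 : 'cV[R]_m).
    by constructor 3; exists b.
  by have [z' h] := orthogonal_partner c kk ka; exists (c *: z').
have [y' [yy' Ny']] : exists y', dot y y' = 0 /\ N2 y' = N2 y.
  by have [y' h] := orthogonal_partner 1 ii ya; exists (1 *: y'); rewrite scale1r in h *.
have [d|[b yb]] : (exists d, y = delta_mx d 0) \/
    exists b : bool, y = delta_mx i 0 + (-1) ^+ b *: delta_mx i' 0.
  by case: ya => [->|->|h]; [left; exists i | left; exists i' | right].
  case: d => d yd; exfalso; rewrite yd in ru yz.
  by apply: (no_swap_delta jj _ ru zz' Nz'); rewrite -yz dot_deltas !eqxx.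
have y2 : dot y y = 2.
  rewrite yb !dotE !dot_deltas !eqxx i'i (negbTE ii) /= !mulr0 !mulr1.
  by rewrite -expr2 sqrr_sign; ring.
have y0 : y != 0 by rewrite -dot_eq0 y2 pnatr_eq0.
case: zc => [zk|[rows [e ze]]].
  exfalso; have c2 : c ^+ 2 = 2.
    by move: yz; rewrite y2 zk dotZl dotZr dot_deltas !eqxx mulr1 -expr2.
  have c0 : c != 0 by rewrite -sqrf_eq0 c2 pnatr_eq0.
  have j'j : j' != j by rewrite eq_sym.
  apply: (@no_swap_delta k j' j (c^-1 *: y) (c^-1 *: y')) => //.
  - by rewrite dotZl dotZr y2 -c2; field.
  - have c0' : - c^-1 != 0 by rewrite oppr_eq0 invr_neq0.
    have := isrootZ c0' ru; congr isroot; rewrite zk.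
    apply/matrixP => p q; rewrite !mxE; case: (q == j); case: (q == j') => /=; field; exact: c0.
  - by rewrite dotZl dotZr yy' !mulr0.
  - by rewrite !(norm_homogeneous (symmetric_is_norm hN2)) Ny'.
have m2 : m = 2%N.
  apply/eqP; rewrite eqn_leq hm andbT -{1}[m]card_ord.
  apply: leq_trans (_ : #|[set k; k']| <= 2)%N; last by rewrite cards2; case: (k == k').
  apply/subset_leq_card/fintype.subsetP => r _; rewrite !inE.
  by case: (rows r) => ->; rewrite eqxx ?orbT.
have k'k : (k' == k) = false by rewrite eq_sym (negbTE kk).
(* As y and z have the same length, c is a sign. *)
have c1 : c ^+ 2 = 1.
  move: yz; rewrite y2 ze !dotE !dot_deltas !eqxx (negbTE kk) k'k /=.
  rewrite !mulr0 !mulr1 addr0 add0r -expr2 sqrr_sign => h; lra.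
have nc : `|c^-1| = 1.
  by move/eqP: c1; rewrite sqrf_eq1 => /orP[] /eqP ->; rewrite ?invrN invr1 ?normrN normr1.
have c0 : c != 0 by rewrite -sqrf_eq0 c1 oner_eq0.
have sg1 : ((-1) ^+ e : R) ^+ 2 = 1 by rewrite sqrr_sign.
pose z2 : 'cV[R]_m := c *: (delta_mx k 0 - (-1) ^+ e *: delta_mx k' 0).
have zz2 : dot z z2 = 0.
  rewrite ze !dotE !dot_deltas !eqxx (negbTE kk) k'k /=.
  rewrite [LHS](_ : _ = c ^+ 2 * (1 - ((-1) ^+ e) ^+ 2)); last by ring.
  by rewrite sg1 subrr mulr0.
have Nz2 : N2 z2 = N2 z.
  apply: symmetric_norm_abs => // r; rewrite ze !mxE !andbT.
  have [->|rk] := eqVneq r k; first by rewrite (negbTE kk) !mulr0 subr0 addr0.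
  by rewrite sub0r add0r !mulrN normrN.
have [p [p1 N1p N2p]] := swap_lp hN1 hN1n hN2 hN2n i jj yz ru y0 yy' zz2 Ny' Nz2.
exists p; split=> //; apply: (is_Ep2_lp_pair m2 p1 hN2n (a := N2 y)) => x.
have ex : x = (c^-1 * ((x k 0 + (-1) ^+ e * x k' 0) / 2)) *: z +
              (c^-1 * ((x k 0 - (-1) ^+ e * x k' 0) / 2)) *: z2.
  apply/colP => r; rewrite ze !mxE !andbT; case: (rows r) => ->.
    by rewrite eqxx (negbTE kk) /=; field.
  transitivity (((-1) ^+ e) ^+ 2 * x k' 0); first by rewrite sg1 mul1r.
  by rewrite eqxx k'k /=; field.
rewrite [in LHS]ex N2p {ex}; congr (_ * _); rewrite !(normrM c^-1) nc !mul1r.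
have half (u : R) : `|u / 2| = `|u| / 2.
  by rewrite normrM (ger0_norm (_ : 0 <= 2^-1)) // invr_ge0 ler0n.
rewrite !half.
have [[kr k'r]|[kr k'r]] : (k = r0 /\ k' = r1) \/ (k = r1 /\ k' = r0).
- case: (row_cases hm m2 k) => ke; case: (row_cases hm m2 k') => k'e.
  + by rewrite ke k'e eqxx in kk.
  + by left.
  + by right.
  + by rewrite ke k'e eqxx in kk.
- rewrite kr k'r; case: e {ze sg1 z2 zz2 Nz2 N2p}; rewrite ?expr1 ?expr0 ?mulN1r ?mul1r //.
  by rewrite opprK lp_pairC.
rewrite kr k'r; case: e {ze sg1 z2 zz2 Nz2 N2p}; rewrite ?expr1 ?expr0 ?mulN1r ?mul1r.
  by rewrite opprK lp_pairC distrC [x r1 0 + _]addrC.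
by rewrite [`|x r1 0 - _|]distrC [x r1 0 + _]addrC.
Qed.

(** By the parallelogram law E_2(2) is the Euclidean plane, so for p = 2 both norms
    would be Euclidean. *)
Lemma exceptional_neq2 p : N1 =1 lp_norm p -> is_Ep2 hm p N2 -> p <> 2%:E.
Proof.
move=> N1p [m2 N2p] p2; apply: hlp; exists p; split=> //.
  by rewrite p2 lee_fin ler1n.
move=> y; rewrite N2p p2 /= (sum_two_rows hm m2); congr (_ `^ _).
rewrite !powR_mulrn // !real_normK ?num_real //; by field.
Qed.

Lemma diagonal_atomE (A : V) : diagonal_atoms hm A <-> exists j (a b : bool),
  A = (-1) ^+ a *: at_col j (delta_mx r0 0 + (-1) ^+ b *: delta_mx r1 0).
Proof.
have h j (y : 'cV[R]_m) : y *m (delta_mx j 0 : 'cV[R]_n)^T = at_col j y.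
  apply/matrixP => i k; rewrite !mxE big_ord1 !mxE andbT.
  by case: (k == j); rewrite ?mulr1 ?mulr0.
split=> -[j [a [b ->]]]; exists j, a, b; first by rewrite h.
by rewrite -h.
Qed.

Lemma Ep_norm_atom p (b : bool) : (1%:E <= p)%E -> Ep_norm p 1 ((-1) ^+ b : R) = Ep_norm p 1 1.
Proof.
move=> p1; case: b; rewrite ?expr1 ?expr0 //.
rewrite /Ep_norm opprK subrr; case: p {p1} => [r| |].
- by congr (_ `^ _); exact: addrC.
- exact: maxC.
- reflexivity.
Qed.

(** In the coordinates along the diagonal atoms, up to a factor, the mixed norm is
    the lp-norm with p different from 2.  The isometry also preserves the Euclidean
    norm, and the atoms are the vectors at which both norms take the value of an
    atom, by [unit_power_sum] or [bigmax_attained]. *)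
Lemma isometry_atom p (T : {linear V -> V}) (A : V) : (1%:E <= p)%E ->
  N1 =1 lp_norm p -> is_Ep2 hm p N2 -> (forall x, N (T x) = N x) ->
  diagonal_atoms hm A -> diagonal_atoms hm (T A).
Proof.
move=> p1 N1p hE hT /diagonal_atomE[j [a [b AE]]]; apply/diagonal_atomE.
have p2 := exceptional_neq2 N1p hE; have [m2 N2p] := hE.
have r01 : (r0 == r1) = false by [].
have r10 : (r1 == r0) = false by [].
pose B := T A; rewrite -/B.
have BB : dot B B = 2.
  rewrite (isometry_dot hN1 hN1n hN2 hN2n hT) AE dotZl dotZr mulrA -expr2 sqrr_sign mul1r.
  rewrite dot_at_col col_at_col eqxx !dotE !dot_deltas !eqxx r01 r10 /=.
  by rewrite !mulr0 !mulr1 addr0 add0r -expr2 sqrr_sign.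
have NB : N B = Ep_norm p 1 1.
  rewrite hT AE (norm_homogeneous (mixed_is_norm hN1 hN2)) normrX normrN1 expr1n mul1r.
  rewrite mixed_at_col // N2p !mxE !eqxx r01 r10 /= !mulr0 !mulr1 addr0 add0r.
  exact: Ep_norm_atom.
(* Absolute values of the coordinates of B, scaled to be 1 at the atoms. *)
pose s (k : 'I_n * bool) := `|B r0 k.1 + (-1) ^+ k.2 * B r1 k.1| / 2.
have s0 k : 0 <= s k by rewrite divr_ge0.
have sE k : s (k, false) = `|B r0 k + B r1 k| / 2 /\ s (k, true) = `|B r0 k - B r1 k| / 2.
  by rewrite /s /= expr0 expr1 mul1r mulN1r.
have sum_pair (f : 'I_n * bool -> R) : \sum_k f k = \sum_j (f (j, false) + f (j, true)).
  rewrite (eq_bigr (fun p => f (p.1, p.2))) => [|[] //].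
  rewrite -(pair_bigA _ (fun i b => f (i, b))) /=; apply: eq_bigr => i _.
  by rewrite big_bool addrC.
have s2 : \sum_k s k ^+ 2 = 1.
  rewrite sum_pair; transitivity (dot B B / 2); last by rewrite BB divff ?pnatr_eq0.
  rewrite /dot exchange_big mulr_suml; apply: eq_bigr => k _ /=.
  rewrite (sum_two_rows hm m2); have [-> ->] := sE k.
  by rewrite !expr_div_n !real_normK ?num_real //; field.
have NBE : N B = lp_norm p (\col_k Ep_norm p (B r0 k) (B r1 k)).
  by rewrite /mixed_norm N1p; congr lp_norm; apply/colP => k; rewrite !mxE N2p !mxE.
have [[k0 b0] sk] : exists k, s k = 1.
  have n2 : `|1 + 1| = 2 :> R by rewrite -[1 + 1]/(2 : R) ger0_norm ?ler0n.
  case: p p1 p2 NB NBE {N1p hE N2p} => [r p1 p2|p1 p2|]; last (by rewrite leeNy_eq); last first.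
    move=> -> /=; rewrite subrr normr0 n2 max_l ?ler0n // => /esym.
    move=> /bigmax_attained [|k]; first by rewrite ltr0n.
    rewrite mxE ger0_norm ?le_max ?normr_ge0 // maxEle; have [e1 e2] := sE k.
    case: ifP => _ h; [exists (k, true) | exists (k, false)].
      by rewrite e2 h divff ?pnatr_eq0.
    by rewrite e1 h divff ?pnatr_eq0.
  rewrite lee_fin in p1; have r0' : 0 < r by apply: lt_le_trans p1.
  have rn0 : r != 0 by rewrite gt_eqF.
  have rn2 : r != 2 by apply/eqP => r2; apply: p2; rewrite r2.
  have V2 : 0 <= 2^-1 :> R by rewrite invr_ge0 ler0n.
  have two : (2 : R) `^ r * 2^-1 `^ r = 1.
    by rewrite -(powRM _ (ler0n _ 2) V2) divff ?pnatr_eq0 // powR1.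
  pose G k := `|B r0 k + B r1 k| `^ r / 2 + `|B r0 k - B r1 k| `^ r / 2.
  have G0 k : 0 <= G k by rewrite addr_ge0 // mulr_ge0 ?powR_ge0.
  move=> -> /= h.
  have hG : \sum_k G k = (2 : R) `^ r / 2.
    have sG : \sum_k `|(\col_k0 Ep_norm r%:E (B r0 k0) (B r1 k0)) k 0| `^ r = \sum_k G k.
      apply: eq_bigr => k _; rewrite mxE /= (ger0_norm (powR_ge0 _ _)).
      exact: (powRVK rn0 (G0 k)).
    rewrite sG subrr normr0 (powR0 rn0) mul0r addr0 n2 in h.
    have SG0 : 0 <= \sum_k G k by apply: sumr_ge0 => k _; exact: G0.
    have P0 : 0 <= (2 : R) `^ r / 2 by exact: (mulr_ge0 (powR_ge0 _ _) V2).
    by have := congr1 (fun t => t `^ r) h; rewrite /= (powRVK rn0 SG0) (powRVK rn0 P0).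
  apply: (unit_power_sum rn2 r0' s0 s2); rewrite sum_pair.
  transitivity (\sum_k G k * (2 * 2^-1 `^ r)).
    apply: eq_bigr => k _; have [-> ->] := sE k.
    by rewrite !(powRM _ (normr_ge0 _) V2) /G; field.
  by rewrite -mulr_suml hG mulrA divfK ?pnatr_eq0.
have others k : k != (k0, b0) -> s k = 0.
  move=> kk; apply/eqP; rewrite -sqrf_eq0; apply/eqP.
  have : \sum_(k | k != (k0, b0)) s k ^+ 2 = 0.
    by move: s2; rewrite (bigD1 (k0, b0)) //= sk expr1n; lra.
  by move=> h; apply: (psumr_eq0P _ h) => // k' _; exact: sqr_ge0.
pose sg : R := (-1) ^+ b0.
have sg2 : sg * sg = 1 by rewrite -expr2 sqrr_sign.
have half0 (t : R) : `|t| / 2 = 0 -> t = 0.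
  by move/eqP; rewrite mulf_eq0 invr_eq0 pnatr_eq0 orbF normr_eq0 => /eqP.
have Y0 : B r1 k0 = sg * B r0 k0.
  have /others : (k0, ~~ b0) != (k0, b0) by rewrite xpair_eqE eqxx /=; case: (b0).
  rewrite /s /= signrN mulNr -/sg => /half0 /eqP; rewrite subr_eq0 => /eqP ->.
  by rewrite mulrA sg2 mul1r.
have [a' X0] : exists a' : bool, B r0 k0 = (-1) ^+ a'.
  move: sk; rewrite /s /= -/sg Y0 mulrA sg2 mul1r -mulr2n -(mulr_natl (B r0 k0)) normrM.
  rewrite ger0_norm ?ler0n // mulrC mulKf ?pnatr_eq0 // => /eqP.
  rewrite eqr_norml ler01 andbT => /orP[] /eqP ->; first by exists false.
  by exists true.
have Z k : k != k0 -> B r0 k = 0 /\ B r1 k = 0.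
  move=> kk; have h (b1 : bool) : B r0 k + (-1) ^+ b1 * B r1 k = 0.
    have /others : (k, b1) != (k0, b0) by rewrite xpair_eqE (negbTE kk).
    by rewrite /s /= => /half0.
  by have := h false; have := h true; rewrite expr0 expr1; lra.
exists k0, a', b0; apply/matrixP => i k; rewrite !mxE !andbT -/sg.
have [->|kk] := eqVneq k k0; last first.
  by have [z0 z1] := Z k kk; case: (row_cases hm m2 i) => ->; rewrite ?z0 ?z1 mulr0n mulr0.
rewrite mulr1n; case: (row_cases hm m2 i) => ->; rewrite ?eqxx ?r01 ?r10 /= ?Y0 X0.
  by rewrite mulr0 addr0 mulr1.
by rewrite add0r mulr1 mulrC.
Qed.
End Main.

Theorem theorem4p1 (R : realType) (m n : nat) (hm : (1 < m)%N)
    (N1 : 'cV[R]_n -> R) (N2 : 'cV[R]_m -> R)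
    (hN1 : symmetric_norm N1) (hN1n : normalized N1)
    (hN2 : symmetric_norm N2) (hN2n : normalized N2)
    (hlp : ~ exists p : \bar R,
      [/\ (1%:E <= p)%E, N1 =1 lp_norm p & N2 =1 lp_norm p])
    (Psi : {linear 'M[R]_(m, n) -> 'M[R]_(m, n)})
    (hPsi : isometry_for (mixed_norm N1 N2) Psi) :
  (exists (S : 'I_n -> {linear 'cV[R]_m -> 'cV[R]_m}) (pi : 'S_n),
     (forall j : 'I_n, isometry_for N2 (S j)) /\
     forall (A : 'M[R]_(m, n)) (j : 'I_n),
       col j (Psi A) = S j (col (pi j) A))
  \/
  (exists p : \bar R,
     [/\ (1%:E <= p)%E, p <> 2%:E, N1 =1 lp_norm p, is_Ep2 hm p N2 &
         set_bij (@diagonal_atoms R m n hm) (@diagonal_atoms R m n hm) Psi]).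
Proof.
have [[v [rv cv]]|nocross] := pselect (exists v, isroot (mixed_norm N1 N2) v /\ cross v).
  right; have [p [p1 N1p hE]] := cross_root_exceptional hm hN1 hN1n hN2 hN2n hlp rv cv.
  exists p; split=> //; first exact: (exceptional_neq2 hlp N1p hE).
  have [Phi [hPhi PsiK PhiK]] := isometry_inverse hN1 hN2 hPsi.
  have atom := isometry_atom hN1 hN1n hN2 hN2n hlp p1 N1p hE.
  split=> [A hA|A B _ _ e|A hA].
  - exact: (atom _ _ hPsi hA).
  - by rewrite -(PhiK A) e PhiK.
  - by exists (Phi A); [exact: (atom _ _ hPhi hA) | exact: PsiK].
left; apply: (column_form hm hN1 hN1n hN2 hN2n hPsi) => u ru cu.
by apply: nocross; exists u.
Qed.
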